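(* For every $c\in[0,1]$ and every function $f\in L^2(\mathbb{T})$ we have $$\frac{1}{2\pi}\left|\left\{\xi\in\mathbb{T} : \mathcal{H}^{\mathbb{T}}f(\xi)\geq 1\right\}\right| \leq c^2\|f\|_2^2+(1-c)^2.$$ For every $c\in[0,1]$ the additive constant $(1-c)^2$ on the right-hand side is optimal, i.e. for every real $K<(1-c)^2$ there exists $f\in L^2(\mathbb{T})$ such that $\frac{1}{2\pi}|\{\xi\in\mathbb{T}:\mathcal{H}^{\mathbb{T}}f(\xi)\geq 1\}|>c^2\|f\|_2^2+K$.
   Context: $\mathbb{T}$ is the unit circle in $\mathbb{C}$, $|A|$ denotes the arc-length measure of $A\subset\mathbb{T}$ (so $|\mathbb{T}|=2\pi$). Functions are real-valued, and $\|f\|_p$ is the $L^p$-norm with respect to the normalized Haar measure on $\mathbb{T}$, i.e. $\|f\|_p^p=\frac1{2\pi}\int_{-\pi}^{\pi}|f(e^{is})|^p\,ds$. The Hilbert transform on the circle is the singular integral (defined for almost every $t$) $$\mathcal{H}^{\mathbb{T}}f(e^{it})=\frac1{2\pi}\,\mathrm{p.v.}\int_{-\pi}^{\pi}f(e^{is})\cot\frac{t-s}{2}\,ds,\qquad f\in L^1(\mathbb{T}).$$ *)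

(* Defs.v *)
From HB Require Import structures.
From mathcomp Require Import all_boot all_order all_algebra.
From mathcomp Require Import all_classical all_reals all_analysis.
From mathcomp Require Import complex.

Set Implicit Arguments.
Unset Strict Implicit.
Unset Printing Implicit Defensive.

Import Order.TTheory GRing.Theory Num.Theory.
Import numFieldNormedType.Exports.

Local Open Scope classical_set_scope.
Local Open Scope ring_scope.

(* A function on the unit circle of R[i] is given as a function on R[i]; only
   its values at the points [expi s] are ever used. *)

Definition expi (R : realType) (s : R) : R[i] := (cos s +i* sin s)%C.

Definition unit_circle (R : realType) : set R[i] := [set z | `|z| = 1].

Definition arclength (R : realType) (A : set R[i]) : \bar R :=
  lebesgue_measure (`]- pi, pi] `&` @expi R @^-1` A).

(* Measurability is Borel measurability; every class in L^p has a Borel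
   representative, and neither the norm nor the Hilbert transform below depends
   on the representative. *)
Definition in_Lp (R : realType) (p : R) (f : R[i] -> R) : Prop :=
  measurable_fun `[- pi, pi] (f \o @expi R) /\
  lebesgue_measure.-integrable `[- pi, pi]
    (fun s => (`|f (expi s)| `^ p)%:E).

Definition Lp_norm (R : realType) (p : R) (f : R[i] -> R) : R :=
  ((2 * pi)^-1 *
     \int[lebesgue_measure]_(s in `[- pi, pi]) (`|f (expi s)| `^ p)) `^ p^-1.

Definition cot (R : realType) (x : R) : R := cos x / sin x.

(* The integrand is 2pi-periodic in [s], so the integral over [-pi, pi] is taken
   over the period centred at the singularity [s = t], from which the symmetric
   neighbourhood of radius [eps] is removed. *)
Definition hilbert_trunc (R : realType) (f : R[i] -> R) (t eps : R) : R :=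
  (2 * pi)^-1 *
    \int[lebesgue_measure]_(s in [set s | eps < `|t - s| <= pi])
      (f (expi s) * cot ((t - s) / 2)).

Definition hilbert_defined (R : realType) (f : R[i] -> R) (t : R) : Prop :=
  cvg (hilbert_trunc f t eps @[eps --> 0^'+]).

(* The value at the point [expi t]; meaningful when [hilbert_defined f t]. *)
Definition hilbert (R : realType) (f : R[i] -> R) (t : R) : R :=
  lim (hilbert_trunc f t eps @[eps --> 0^'+]).

(* The points of the circle at which the principal value exists and is at least
   [a]; by periodicity this does not depend on the argument [t] of [xi]. *)
Definition hilbert_ge (R : realType) (f : R[i] -> R) (a : R) : set R[i] :=
  [set xi | unit_circle xi /\
     exists t, [/\ xi = expi t, hilbert_defined f t & a <= hilbert f t]].

(* Main.v *)
Require Import Defs.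
From HB Require Import structures.
From mathcomp Require Import all_boot all_order all_algebra.
From mathcomp Require Import all_classical all_reals all_analysis.
From mathcomp Require Import complex measurable_realfun.
From mathcomp Require Import ring lra zify.

Set Implicit Arguments.
Unset Strict Implicit.
Unset Printing Implicit Defensive.

Import Order.TTheory GRing.Theory Num.Theory.
Import numFieldNormedType.Exports.

Local Open Scope classical_set_scope.
Local Open Scope ring_scope.

(** For [0 <= c <= 1] one has [1 <= (c y + 1 - c)^2] whenever [1 <= y], so the
    measure of [{Hf >= 1}] is at most the mean of [(c Hf + 1 - c)^2], which is at
    most [c^2 ||f||^2 + (1 - c)^2] because [Hf] has mean zero and [||Hf|| <= ||f||].
    To avoid the [L^2] theory of [H], replace [Hf] by the convolutions [Q_m f] of
    [f] with [cot (x/2) (1 - cos^(2m) (x/2))].  These kernels are sine polynomials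
    with multipliers in [[0, 1]] (they are averages of modified conjugate Dirichlet
    kernels), so Bessel's inequality bounds [||Q_m f||]; and since the weight
    [1 - cos^(2m) (x/2)] increases on [[0, pi]], [Q_m f (t)] tends to [Hf(t)] at
    every point where the principal value exists.  Fatou's lemma concludes.

    For the optimality, let [g] be a polynomial in [cos t] close to the indicator
    of an arc of normalized length [b] and [m] its mean.  Then [(g - m) / (1 - m)]
    is at least about 1 on the arc and is the Hilbert transform of its conjugate
    sine polynomial, whose squared norm is about [b / (1 - b)]; take [b = 1 - c]. *)

(** * Translation invariance and periodic integrals *)

(** The kernels are chosen to make the [L^2] estimate finite-dimensional: convolution with a sine
    polynomial yields a trigonometric polynomial, whose norm is a finite sum of squares controlled
    by Bessel's inequality for [f]. Pointwise convergence rests on the second mean value theorem: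
    inside an annulus around the singularity, the superlevel sets of an increasing weight are again
    annuli, over which the singular integral is a difference of two truncated transforms, small by
    the Cauchy criterion. The set to be measured is enclosed in a measurable one, the points where
    the lower limit of [(c Q_m f + 1 - c)^2] is at least 1, and Markov's inequality is applied
    there.

    For the optimality, the indicator of the arc has variance [b (1 - b)], and division by
    [(1 - b)^2] gives [b / (1 - b)]. The gain [b - c^2 b / (1 - b)] is stationary where
    [(1 - b)^2 = c^2], hence [b = 1 - c], and its value there is [(1 - c)^2]. For [c = 0] and
    [c = 1] this arc is the whole circle or a point, so the optimum is only approached. *)

Lemma measurable_shift (R : realType) (a : R) :
  measurable_fun [set: R] (fun x : R => x + a).
Proof.
by apply: continuous_measurable_fun => x; apply: cvgD; [exact: cvg_id|exact: cvg_cst].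
Qed.

Lemma preimage_shift_itv (R : realType) (a b c : R) x y :
  (fun x : R => x + c) @^-1` [set` Interval (BSide x a) (BSide y b)] =
  [set` Interval (BSide x (a - c)) (BSide y (b - c))].
Proof.
apply/seteqP; split => z /=; rewrite !in_itv/= => /andP[]; case: x; case: y => /= h1 h2;
 by apply/andP; split; lra.
Qed.

Lemma lebesgue_measure_shift (R : realType) (a : R) (A : set R) : measurable A ->
  pushforward lebesgue_measure ((fun x => x + a) : _ -> measurableTypeR R) A =
  lebesgue_measure A.
Proof.
move=> mA; apply/esym/lebesgue_measure_unique => //=.
  exact: measurable_shift.
move=> ? _ [[u v]] _ <-.
rewrite /pushforward preimage_shift_itv !lebesgue_measure_itv /= !lte_fin ltrD2r.
by case: ifP => // _; rewrite -!EFinD; congr (_%:E); ring.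
Qed.

Lemma ge0_integral_shift (R : realType) (a : R) (D : set R) (f : R -> \bar R) :
  measurable D -> measurable_fun D f -> (forall x, (0 <= f x)%E) ->
  (\int[lebesgue_measure]_(x in D) f x =
   \int[lebesgue_measure]_(x in (fun x => (x + a)%R) @^-1` D) f (x + a)%R)%E.
Proof.
move=> mD mf f0.
transitivity (\int[pushforward lebesgue_measure
    ((fun x => (x + a)%R) : R -> measurableTypeR R)]_(x in D) f x)%E; last first.
  by rewrite ge0_integral_pushforward//; exact: measurable_shift.
apply: eq_measure_integral => /=; first exact: measurable_shift.
by move=> ? A mA _; exact/esym/lebesgue_measure_shift.
Qed.

Section periodic_integral.
Context (R : realType) (T : R) (T0 : 0 < T).

Lemma periodic_intr (U : Type) (f : R -> U) : (forall x, f (x + T) = f x) ->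
  forall (k : int) x, f (x + k%:~R * T) = f x.
Proof.
move=> pf; have pn (n : nat) x : f (x + n%:R * T) = f x.
  elim: n => [|n IH]; first by rewrite mul0r addr0.
  by rewrite -natr1 mulrDl mul1r addrA pf.
move=> [n|n] x; first exact: pn.
by rewrite NegzE -(pn n.+1 (x + _)) mulrNz mulNr addrNK.
Qed.

(** Moving [b] by a multiple of [T] gives [b'] with [b' <= a < b' + T]. The two periods then share
    []a, b' + T]], and the remaining pieces []b', a]] and []b' + T, a + T]] are translates of each
    other. *)
Lemma ge0_integral_periodic (f : R -> \bar R) (a b : R) :
  (forall x, f (x + T)%R = f x) -> measurable_fun setT f -> (forall x, 0 <= f x)%E ->
  (\int[lebesgue_measure]_(x in `]a, (a + T)%R]) f x =
   \int[lebesgue_measure]_(x in `]b, (b + T)%R]) f x)%E.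
Proof.
move=> pf mf f0.
have mfS D : measurable D -> measurable_fun D f by move=> ?; exact: measurable_funTS.
have shiftI c d (k : int) : (\int[lebesgue_measure]_(x in `](c + k%:~R * T)%R, (d + k%:~R * T)%R]) f x =
    \int[lebesgue_measure]_(x in `]c, d]) f x)%E.
  rewrite (@ge0_integral_shift _ (k%:~R * T))//; last exact: mfS.
  rewrite preimage_shift_itv !addrK; apply: eq_integral => x _.
  by rewrite periodic_intr.
pose k := Num.floor ((a - b) / T).
pose b' := b + k%:~R * T.
have /andP[h1 h2] : (b' <= a < b' + T)%R.
  have := floor_le_tmp ((a - b) / T); have := floorD1_gt ((a - b) / T).
  rewrite -/k intrD ltr_pdivrMr// ler_pdivlMr// => ? ?.
  by apply/andP; split; rewrite /b'; lra.
transitivity (\int[lebesgue_measure]_(x in `]b', (b' + T)%R]) f x)%E; last first.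
  by rewrite /b' -addrA [_ * T + T]addrC addrA shiftI.
have split3 x y z : (x <= y <= z)%R ->
   (\int[lebesgue_measure]_(x in `]x, z]) f x = \int[lebesgue_measure]_(x in `]x, y]) f x
     + \int[lebesgue_measure]_(x in `]y, z]) f x)%E.
  move=> /andP[xy yz].
  have -> : `]x, z]%classic = `]x, y] `|` `]y, z].
    apply/seteqP; split => w /=; rewrite !in_itv/=.
      by move=> /andP[? ?]; case: (leP w y) => ?; [left|right]; apply/andP; split.
    by case=> /andP[? ?]; apply/andP; split => //; lra.
  apply: ge0_integral_setU => //=; first by apply: mfS; exact: measurableU.
  apply/disj_setPS => w [/=]; rewrite !in_itv /= => /andP[_ h3] /andP[h4 _].
  by move: h3; rewrite leNgt h4.
rewrite (split3 a (b' + T) (a + T)); last by apply/andP; split; lra.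
rewrite (split3 b' a (b' + T)); last by apply/andP; split; lra.
rewrite addeC; congr (_ + _)%E.
by rewrite -(shiftI b' a 1) mul1r.
Qed.

End periodic_integral.

Section periodic_real.
Context (R : realType) (h : R -> R).
Hypothesis ph : forall x, h (x + 2 * pi) = h x.
Notation mu := (@lebesgue_measure R).

Let T0 : 0 < 2 * pi :> R. Proof. by rewrite mulr_gt0// pi_gt0. Qed.

Lemma measurable_fun_periodic :
  measurable_fun `[- pi, pi] h -> measurable_fun setT h.
Proof.
move=> mh.
pose E (k : int) : set R := `[- pi + k%:~R * (2 * pi), pi + k%:~R * (2 * pi)]%classic.
have mE k : measurable_fun (E k) h.
  have -> : h = h \o (fun x => x - k%:~R * (2 * pi)).
    by apply/funext => x /=; rewrite -mulNr -mulrNz periodic_intr.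
  apply: (measurable_comp (F := `[- pi, pi])) => //.
    move=> _ [x /= + <-]; rewrite /E/= !in_itv/= => /andP[? ?].
    by apply/andP; split; lra.
  by apply: measurable_funTS; exact: measurable_shift.
(* The periods are indexed by integers but countable unions by naturals, so [n] and [- n] are taken
   together. *)
have -> : [set: R] = \bigcup_n (E n%:Z `|` E (- n%:Z)).
  apply/esym; rewrite -subTset => x _.
  pose k := Num.floor ((x + pi) / (2 * pi)).
  have := floor_le_tmp ((x + pi) / (2 * pi)); have := floorD1_gt ((x + pi) / (2 * pi)).
  rewrite -/k intrD ltr_pdivrMr// ler_pdivlMr// => h1 h2.
  have Ek : E k x by rewrite /E/= in_itv/=; apply/andP; split; lra.
  case: k Ek {h1 h2} => [n|n] Ek; first by exists n => //; left.
  by exists n.+1 => //; right; rewrite -NegzE.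
have mEk k : measurable (E k) by exact: measurable_itv.
apply/(measurable_fun_bigcup h (fun n => measurableU _ _ (mEk n%:Z) (mEk (- n%:Z)))).
by move=> n; apply/measurable_funU.
Qed.

Let oc_cc (g : R -> \bar R) (t : R) : measurable_fun setT g ->
  (\int[mu]_(x in `[(t - pi)%R, (t + pi)%R]) g x =
   \int[mu]_(x in `](t - pi)%R, (t + pi)%R]) g x)%E.
Proof.
move=> mg; rewrite integral_itv_obnd_cbnd//; exact: measurable_funTS.
Qed.

Lemma ge0_integral_periodic_itv (g : R -> \bar R) (t : R) :
  (forall x, g (x + 2 * pi)%R = g x) -> measurable_fun setT g ->
  (forall x, 0 <= g x)%E ->
  (\int[mu]_(x in `[(t - pi)%R, (t + pi)%R]) g x =
   \int[mu]_(x in `[(- pi)%R, pi]) g x)%E.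
Proof.
move=> pg mg g0; have := oc_cc 0 mg; rewrite !add0r => E0; rewrite oc_cc//.
have e (a : R) : a + pi = a - pi + 2 * pi by ring.
by rewrite e (ge0_integral_periodic T0 _ (0 - pi) pg)// -e !add0r E0.
Qed.

Hypothesis ih : mu.-integrable `[- pi, pi] (EFin \o h).

Let mh : measurable_fun setT h.
Proof. by apply: measurable_fun_periodic; apply/measurable_EFinP; case/integrableP : ih. Qed.

Lemma integrable_periodic t : mu.-integrable `[t - pi, t + pi] (EFin \o h).
Proof.
apply/integrableP; split; first exact/measurable_EFinP/measurable_funTS.
rewrite ge0_integral_periodic_itv//.
- by case/integrableP : ih.
- by move=> x /=; rewrite ph.
- by apply: measurableT_comp => //; exact/measurable_EFinP.
Qed.

Lemma Rintegral_periodic t :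
  \int[mu]_(x in `[t - pi, t + pi]) h x = \int[mu]_(x in `[- pi, pi]) h x.
Proof.
have mEh : measurable_fun setT (EFin \o h) by exact/measurable_EFinP.
rewrite /Rintegral integralE [in RHS]integralE; congr (fine (_ - _)%E);
  apply: ge0_integral_periodic_itv => //.
- by move=> x; rewrite !funeposE /= ph.
- exact: measurable_funepos.
- by move=> x; rewrite !funenegE /= ph.
- exact: measurable_funeneg.
Qed.

End periodic_real.

(** * Trigonometric polynomials *)

Section integrals_on_segments.
Context (R : realType).
Notation mu := (@lebesgue_measure R).

Lemma continuous_sqr (f : R -> R) : continuous f -> continuous (fun x => f x ^+ 2).
Proof.
move=> cf x; apply: (@continuous_comp _ _ _ f (fun y => y ^+ 2)); first exact: cf.
exact: exprn_continuous.
Qed.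

Lemma continuous_reflect (f : R -> R) (t : R) : continuous f ->
  continuous (fun x => f (t - x)).
Proof.
move=> cf x; apply: (@continuous_comp _ _ _ (fun x => t - x) f); last exact: cf.
by apply: cvgB; [exact: cvg_cst|exact: cvg_id].
Qed.

Lemma continuous_integrable_itv (f : R -> R) (a b : R) : continuous f ->
  mu.-integrable `[a, b] (EFin \o f).
Proof.
move=> cf; apply: continuous_compact_integrable; first exact: segment_compact.
exact: continuous_subspaceT.
Qed.

Lemma integrable_mul_continuous (h u : R -> R) (a b : R) :
  mu.-integrable `[a, b] (EFin \o h) -> continuous u ->
  mu.-integrable `[a, b] (EFin \o (fun x => h x * u x)).
Proof.
move=> ih cu.
have -> : EFin \o (fun x => h x * u x) = ((EFin \o h) \* (EFin \o u))%E.
  by apply/funext => x /=; rewrite EFinM.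
apply: integrableMl => //.
  by apply: measurable_funTS; exact: continuous_measurable_fun.
have : compact (u @` `[a, b]).
  by apply: continuous_compact; [exact: continuous_subspaceT|exact: segment_compact].
move=> /(@compact_bounded _ R^o) [M [Mr HM]]; exists M; split => // x Mx y aby.
by apply: (HM x Mx); exists y.
Qed.

Lemma integrable_scale (D : set R) (c : R) (f : R -> R) : measurable D ->
  mu.-integrable D (EFin \o f) -> mu.-integrable D (EFin \o (fun x => c * f x)).
Proof. by move=> mD; exact: (@integrableZl _ _ _ mu D mD c (EFin \o f)). Qed.

Lemma integrable_add (D : set R) (f g : R -> R) : measurable D ->
  mu.-integrable D (EFin \o f) -> mu.-integrable D (EFin \o g) ->
  mu.-integrable D (EFin \o (fun x => f x + g x)).
Proof. by move=> mD; exact: (@integrableD _ _ _ mu D mD (EFin \o f) (EFin \o g)). Qed.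

Lemma integrable_sub (D : set R) (f g : R -> R) : measurable D ->
  mu.-integrable D (EFin \o f) -> mu.-integrable D (EFin \o g) ->
  mu.-integrable D (EFin \o (fun x => f x - g x)).
Proof. by move=> mD; exact: (@integrableB _ _ _ mu D mD (EFin \o f) (EFin \o g)). Qed.

Lemma integrable_bigsum (D : set R) (I : Type) (s : seq I) (P : pred I) (F : I -> R -> R) :
  measurable D ->
  (forall i, P i -> mu.-integrable D (EFin \o F i)) ->
  mu.-integrable D (EFin \o (fun x => \sum_(i <- s | P i) F i x)).
Proof.
move=> mD iF.
have := @integrable_sum _ _ _ mu D mD _ s P (fun i => EFin \o F i) iF.
by apply: eq_integrable => // x _ /=; rewrite sumEFin.
Qed.

Lemma Rintegral_sum (D : set R) (I : Type) (s : seq I) (P : pred I) (F : I -> R -> R) :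
  measurable D ->
  (forall i, P i -> mu.-integrable D (EFin \o F i)) ->
  \int[mu]_(x in D) (\sum_(i <- s | P i) F i x) =
  \sum_(i <- s | P i) \int[mu]_(x in D) F i x.
Proof.
move=> mD iF; elim: s => [|i s IH].
  under eq_Rintegral do rewrite big_nil.
  by rewrite big_nil Rintegral_cst// mul0r.
under eq_Rintegral do rewrite big_cons.
rewrite big_cons; case: ifP => // Pi.
rewrite RintegralD ?IH//; first exact: iF.
exact: integrable_bigsum.
Qed.

Lemma Rintegral_FTC (f F : R -> R) (a b : R) : a < b -> continuous f ->
  (forall x : R, is_derive x 1 F (f x)) ->
  \int[mu]_(x in `[a, b]) f x = F b - F a.
Proof.
move=> ab cf dF.
have cF : continuous F.
  move=> x; apply: differentiable_continuous; apply/derivable1_diffP.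
  by have [] := dF x.
rewrite /Rintegral (@continuous_FTC2 _ f F)//.
- exact: continuous_subspaceT.
- split.
  + by move=> x _; have [] := dF x.
  + exact/cvg_at_right_filter/cF.
  + exact/cvg_at_left_filter/cF.
- by move=> x _; rewrite derive1E; have [_ ->] := dF x.
Qed.

End integrals_on_segments.

Section trig_integrals.
Context (R : realType).
Notation mu := (@lebesgue_measure R).

Lemma continuous_sinM (r : R) : continuous (fun x => sin (r * x)).
Proof.
by move=> x; apply: continuous_comp; [apply: mulrl_continuous|exact: continuous_sin].
Qed.

Lemma continuous_cosM (r : R) : continuous (fun x => cos (r * x)).
Proof.
by move=> x; apply: continuous_comp; [apply: mulrl_continuous|exact: continuous_cos].
Qed.

Lemma sin_intr_pi (k : int) : sin (k%:~R * pi) = 0 :> R.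
Proof.
have H (n : nat) : sin (n%:R * pi) = 0 :> R.
  elim: n => [|n IH]; first by rewrite mul0r sin0.
  by rewrite -natr1 mulrDl mul1r sinDpi IH oppr0.
by case: k => n; [exact: H|rewrite NegzE mulrNz mulNr sinN H oppr0].
Qed.

Let NpiLpi : (- pi : R) < pi.
Proof. by rewrite gtrN// pi_gt0. Qed.

Lemma Rintegral_cosM (k : int) : k != 0 ->
  \int[mu]_(x in `[- pi, pi]) cos (k%:~R * x) = 0.
Proof.
move=> k0; have k0' : k%:~R != 0 :> R by rewrite intr_eq0.
have dF (x : R) : is_derive x 1 (fun x => k%:~R^-1 * sin (k%:~R * x)) (cos (k%:~R * x)).
  have := is_deriveM (is_derive_cst (k%:~R^-1 : R) x 1)
     (is_derive1_comp (is_derive_sin (k%:~R * x)) (is_deriveZ k%:~R (is_derive_id x 1))).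
  move/is_derive_eq; apply.
  by rewrite /GRing.scale /=; field.
rewrite (Rintegral_FTC NpiLpi (@continuous_cosM _) dF).
by rewrite mulrN sinN !sin_intr_pi !mulr0 oppr0 mulr0 subrr.
Qed.

Lemma Rintegral_sinM (r : R) : \int[mu]_(x in `[- pi, pi]) sin (r * x) = 0.
Proof.
have [->|r0] := eqVneq r 0.
  under eq_Rintegral do rewrite mul0r sin0.
  by rewrite Rintegral_cst// mul0r.
have dF (x : R) : is_derive x 1 (fun x => - r^-1 * cos (r * x)) (sin (r * x)).
  have := is_deriveM (is_derive_cst (- r^-1 : R) x 1)
     (is_derive1_comp (is_derive_cos (r * x)) (is_deriveZ r (is_derive_id x 1))).
  move/is_derive_eq; apply.
  by rewrite /GRing.scale /=; field.
rewrite (Rintegral_FTC NpiLpi (@continuous_sinM _) dF).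
by rewrite mulrN cosN subrr.
Qed.

(** [true] selects the sine. The frequency is [n.+1], which excludes the constant mode: every
    combination of these functions has mean zero. *)
Definition trig (b : bool) (n : nat) (x : R) : R :=
  if b then sin (n.+1%:R * x) else cos (n.+1%:R * x).

Lemma continuous_trig b n : continuous (trig b n).
Proof. by case: b; [exact: continuous_sinM|exact: continuous_cosM]. Qed.

Lemma Rintegral_trig b n : \int[mu]_(x in `[- pi, pi]) trig b n x = 0.
Proof. by case: b; [exact: Rintegral_sinM|exact: (@Rintegral_cosM n.+1)]. Qed.

Lemma Rintegral_trig_mul b b' n m :
  \int[mu]_(x in `[- pi, pi]) (trig b n x * trig b' m x) =
  if (b == b') && (n == m) then pi else 0.
Proof.
have pi2 : \int[mu]_(x in `[- pi, pi]) (1 : R) = 2 * pi.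
  rewrite Rintegral_cst//= lebesgue_measure_itv/= lte_fin NpiLpi/= mul1r.
  by ring.
have icos (r : R) : mu.-integrable `[-pi, pi] (EFin \o (fun x => cos (r * x))).
  by apply: continuous_integrable_itv; exact: continuous_cosM.
have isin (r : R) : mu.-integrable `[-pi, pi] (EFin \o (fun x => sin (r * x))).
  by apply: continuous_integrable_itv; exact: continuous_sinM.
(* Difference and sum of the frequencies [n.+1] and [m.+1]. The sum is never zero, so a nonzero
   integral can only come from [d = 0]. *)
pose d : int := n%:Z - m%:Z; pose s : int := n%:Z + m%:Z + 2.
have dE : d%:~R = n%:R - m%:R :> R by rewrite /d rmorphB.
have sE : s%:~R = n%:R + m%:R + 2 :> R by rewrite /s !rmorphD.
have s0 : s != 0 by rewrite /s; lia.
have Id : \int[mu]_(x in `[- pi, pi]) cos (d%:~R * x) = if n == m then 2 * pi else 0 :> R.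
  case: eqVneq => nm; last by apply: Rintegral_cosM; rewrite /d; lia.
  rewrite -pi2; apply: eq_Rintegral => x _.
  by rewrite dE nm subrr mul0r cos0.
have Is := Rintegral_cosM s0.
have expand (u v : R -> R) c : mu.-integrable `[-pi, pi] (EFin \o u) ->
   mu.-integrable `[-pi, pi] (EFin \o v) ->
  \int[mu]_(x in `[- pi, pi]) (2^-1 * (u x + c * v x)) =
  2^-1 * (\int[mu]_(x in `[- pi, pi]) u x + c * \int[mu]_(x in `[- pi, pi]) v x).
  move=> iu iv.
  have icv := integrable_scale c (measurable_itv _) iv.
  rewrite RintegralZl//; last exact: integrable_add.
  by rewrite RintegralD// RintegralZl.
case: b b' => [] [] /=.
- transitivity (\int[mu]_(x in `[- pi, pi]) (2^-1 * (cos (d%:~R * x) + (-1) * cos (s%:~R * x)))).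
    apply: eq_Rintegral => x _.
    have -> : d%:~R * x = n.+1%:R * x - m.+1%:R * x by rewrite dE -!natr1; ring.
    have -> : s%:~R * x = n.+1%:R * x + m.+1%:R * x by rewrite sE -!natr1; ring.
    by rewrite cosB cosD; field.
  by rewrite expand// Id Is; case: ifP => _; field.
- transitivity (\int[mu]_(x in `[- pi, pi]) (2^-1 * (sin (d%:~R * x) + 1 * sin (s%:~R * x)))).
    apply: eq_Rintegral => x _.
    have -> : d%:~R * x = n.+1%:R * x - m.+1%:R * x by rewrite dE -!natr1; ring.
    have -> : s%:~R * x = n.+1%:R * x + m.+1%:R * x by rewrite sE -!natr1; ring.
    by rewrite sinB sinD; field.
  by rewrite expand// !Rintegral_sinM; field.
- transitivity (\int[mu]_(x in `[- pi, pi]) (2^-1 * (sin (s%:~R * x) + (-1) * sin (d%:~R * x)))).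
    apply: eq_Rintegral => x _.
    have -> : d%:~R * x = n.+1%:R * x - m.+1%:R * x by rewrite dE -!natr1; ring.
    have -> : s%:~R * x = n.+1%:R * x + m.+1%:R * x by rewrite sE -!natr1; ring.
    by rewrite sinB sinD; field.
  by rewrite expand// !Rintegral_sinM; field.
- transitivity (\int[mu]_(x in `[- pi, pi]) (2^-1 * (cos (d%:~R * x) + 1 * cos (s%:~R * x)))).
    apply: eq_Rintegral => x _.
    have -> : d%:~R * x = n.+1%:R * x - m.+1%:R * x by rewrite dE -!natr1; ring.
    have -> : s%:~R * x = n.+1%:R * x + m.+1%:R * x by rewrite sE -!natr1; ring.
    by rewrite cosB cosD; field.
  by rewrite expand// Id Is; case: ifP => _; field.
Qed.

End trig_integrals.

Section trig_polynomials.
Context (R : realType).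
Notation mu := (@lebesgue_measure R).
Notation D := (`[- (pi : R), pi]%classic : set R).
Implicit Types (a : bool -> nat -> R) (h : R -> R).

Definition trig_poly (N : nat) a (x : R) : R :=
  \sum_(n < N) (a false n * trig false n x + a true n * trig true n x).

Lemma continuous_trig_poly N a : continuous (trig_poly N a).
Proof.
elim: N => [|N IH] x.
  have -> : trig_poly 0 a = cst 0 by apply/funext => y; rewrite /trig_poly big_ord0.
  exact: cvg_cst.
have -> : trig_poly N.+1 a = (fun y => trig_poly N a y +
    (a false N * trig false N y + a true N * trig true N y)).
  by apply/funext => y; rewrite /trig_poly big_ord_recr.
apply: cvgD; first exact: IH.
by apply: cvgD; apply: cvgM; do ?[exact: cvg_cst|exact: continuous_trig].
Qed.

(** No factor [1 / pi] is included; it appears explicitly in [bessel_inequality]. *)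
Definition fourier_coef h (b : bool) (n : nat) : R :=
  \int[mu]_(x in D) (h x * trig b n x).

Lemma integrable_mul_trig h b n : mu.-integrable D (EFin \o h) ->
  mu.-integrable D (EFin \o (fun x => h x * trig b n x)).
Proof. by move=> ih; apply: integrable_mul_continuous => //; exact: continuous_trig. Qed.

Lemma Rintegral_mul_trig_poly N a h : mu.-integrable D (EFin \o h) ->
  \int[mu]_(x in D) (h x * trig_poly N a x) =
  \sum_(n < N) (a false n * fourier_coef h false n + a true n * fourier_coef h true n).
Proof.
move=> ih; have mD : measurable D by exact: measurable_itv.
have iht b n := integrable_scale (a b n) mD (integrable_mul_trig b n ih).
transitivity (\int[mu]_(x in D) \sum_(n < N) (a false n * (h x * trig false n x)
    + a true n * (h x * trig true n x))).
  apply: eq_Rintegral => x _; rewrite mulr_sumr; apply: eq_bigr => n _; ring.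
rewrite Rintegral_sum//; last by move=> i _; exact: integrable_add.
apply: eq_bigr => n _; rewrite RintegralD//.
by rewrite !RintegralZl//; exact: integrable_mul_trig.
Qed.

Lemma fourier_coef_trig_poly N a b (n : 'I_N) :
  fourier_coef (trig_poly N a) b n = pi * a b n.
Proof.
rewrite /fourier_coef.
under eq_Rintegral do rewrite mulrC.
rewrite Rintegral_mul_trig_poly; last first.
  by apply: continuous_integrable_itv; exact: continuous_trig.
have tE b' (i : 'I_N) : fourier_coef (trig b n) b' i = if (b == b') && (n == i) then pi else 0.
  exact: Rintegral_trig_mul.
rewrite (bigD1 n)//= !tE eqxx !andbT big1.
  by case: b {tE} => /=; ring.
by move=> i /negPf ni; rewrite !tE [n == i]eq_sym ni !andbF !mulr0 addr0.
Qed.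

Lemma Rintegral_trig_poly_sq N a :
  \int[mu]_(x in D) (trig_poly N a x ^+ 2) =
  pi * \sum_(n < N) (a false n ^+ 2 + a true n ^+ 2).
Proof.
under eq_Rintegral do rewrite expr2.
rewrite Rintegral_mul_trig_poly; last first.
  by apply: continuous_integrable_itv; exact: continuous_trig_poly.
rewrite mulr_sumr; apply: eq_bigr => n _.
by rewrite !fourier_coef_trig_poly; ring.
Qed.

Lemma Rintegral_trig_poly N a : \int[mu]_(x in D) trig_poly N a x = 0.
Proof.
have i b n : mu.-integrable D (EFin \o (fun x => a b n * trig b n x)).
  apply: integrable_scale; first exact: measurable_itv.
  by apply: continuous_integrable_itv; exact: continuous_trig.
rewrite /trig_poly Rintegral_sum//; last by move=> n _; exact: integrable_add.
rewrite big1// => n _; rewrite RintegralD// !RintegralZl//; last 2 first.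
- by apply: continuous_integrable_itv; exact: continuous_trig.
- by apply: continuous_integrable_itv; exact: continuous_trig.
by rewrite !Rintegral_trig !mulr0 addr0.
Qed.

(** With [p] the orthogonal projection of [h] onto the first [N] frequencies, the integrals of [h p]
    and of [p^2] both equal the left-hand side, and the integral of [(h - p)^2] is nonnegative. *)
Lemma bessel_inequality N h : mu.-integrable D (EFin \o h) ->
  mu.-integrable D (EFin \o (fun x => h x ^+ 2)) ->
  pi^-1 * \sum_(n < N) (fourier_coef h false n ^+ 2 + fourier_coef h true n ^+ 2)
  <= \int[mu]_(x in D) (h x ^+ 2).
Proof.
move=> ih ih2; have mD : measurable D by exact: measurable_itv.
set S := \sum_(n < N) _.
(* Coefficients of the projection: each function [trig b n] has squared norm [pi]. *)
pose a b n := pi^-1 * fourier_coef h b n.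
have ip : mu.-integrable D (EFin \o (fun x => trig_poly N a x ^+ 2)).
  by apply: continuous_integrable_itv; apply: continuous_sqr; exact: continuous_trig_poly.
have ihp : mu.-integrable D (EFin \o (fun x => h x * trig_poly N a x)).
  by apply: integrable_mul_continuous => //; exact: continuous_trig_poly.
have E1 : \int[mu]_(x in D) (h x * trig_poly N a x) = pi^-1 * S.
  rewrite Rintegral_mul_trig_poly// /S mulr_sumr; apply: eq_bigr => n _.
  by rewrite /a; ring.
have E2 : \int[mu]_(x in D) (trig_poly N a x ^+ 2) = pi^-1 * S.
  rewrite Rintegral_trig_poly_sq /S !mulr_sumr; apply: eq_bigr => n _.
  have : pi != 0 :> R by rewrite gt_eqF// pi_gt0.
  by rewrite /a; move: (pi : R) => p p0; field.
have : 0 <= \int[mu]_(x in D) ((h x - trig_poly N a x) ^+ 2).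
  by apply: Rintegral_ge0 => x _; exact: sqr_ge0.
have -> : \int[mu]_(x in D) ((h x - trig_poly N a x) ^+ 2) =
  \int[mu]_(x in D) (h x ^+ 2 + ((-2) * (h x * trig_poly N a x) + trig_poly N a x ^+ 2)).
  by apply: eq_Rintegral => x _; ring.
have ihp2 := integrable_scale (- 2) mD ihp.
rewrite RintegralD//; last exact: integrable_add.
rewrite RintegralD// RintegralZl// E1 E2.
by lra.
Qed.

End trig_polynomials.

(** * Convolution with sine polynomials *)

Section conjugate_kernels.
Context (R : realType).
Notation mu := (@lebesgue_measure R).
Notation D := (`[- (pi : R), pi]%classic : set R).
Variables (N : nat) (l : nat -> R).

Definition sine_poly (x : R) : R := \sum_(n < N) (l n * trig true n x).

Lemma continuous_sine_poly : continuous sine_poly.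
Proof.
move=> x; have -> : sine_poly = trig_poly N (fun b n => if b then l n else 0).
  by apply/funext => y; apply: eq_bigr => n _; rewrite mul0r add0r.
exact: continuous_trig_poly.
Qed.

Lemma sine_poly_periodic x : sine_poly (x + 2 * pi) = sine_poly x.
Proof.
apply: eq_bigr => n _; congr (_ * _); rewrite /trig mulrDr.
apply: (@periodic_intr _ (2 * pi) _ sin _ n.+1%:Z) => y.
by rewrite [2 * pi]mulr_natl sinD2pi.
Qed.

Variable h : R -> R.
Hypothesis ih : mu.-integrable D (EFin \o h).

(** Conjugation exchanges sine and cosine coefficients up to sign. The factor 2 comes from the
    formal expansion of [cot (x / 2)] as twice the sum of all [sin (n x)], [n >= 1]. *)
Let a (b : bool) n := if b then 2 * l n * fourier_coef h false n
                      else - (2 * l n * fourier_coef h true n).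

Lemma sine_conv t : \int[mu]_(s in D) (h s * (2 * sine_poly (t - s))) = trig_poly N a t.
Proof.
pose b (b : bool) n := if b then - (2 * l n * trig false n t) else 2 * l n * trig true n t.
transitivity (\int[mu]_(s in D) (h s * trig_poly N b s)).
  apply: eq_Rintegral => s _; congr (_ * _).
  rewrite /sine_poly mulr_sumr; apply: eq_bigr => n _.
  by rewrite /b /trig mulrBr sinB; ring.
by rewrite Rintegral_mul_trig_poly//; apply: eq_bigr => n _; rewrite /a /b; ring.
Qed.

Hypothesis ih2 : mu.-integrable D (EFin \o (fun x => h x ^+ 2)).
Hypothesis l01 : forall n, 0 <= l n <= 1.

(** Multipliers in [[0, 1]] do not increase Fourier coefficients, so Bessel's inequality applies.
    The constant [(2 * pi) ^+ 2] compensates for the convolution being taken without its factor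
    [(2 * pi)^-1]. *)
Lemma sine_conv_sq : \int[mu]_(t in D) (trig_poly N a t ^+ 2) <=
  (2 * pi) ^+ 2 * \int[mu]_(s in D) (h s ^+ 2).
Proof.
rewrite Rintegral_trig_poly_sq.
have := @bessel_inequality R N h ih ih2.
set S := \sum_(n < N) _; set J := Rintegral _ _ _ => H.
have {}H : S <= pi * J by rewrite -ler_pdivrMl// pi_gt0.
have : \sum_(n < N) (a false n ^+ 2 + a true n ^+ 2) <= 4 * S.
  rewrite /S mulr_sumr; apply: ler_sum => n _; rewrite /a.
  have /andP[l0 l1] := l01 n.
  have : l n ^+ 2 <= 1 by rewrite expr_le1.
  have := sqr_ge0 (fourier_coef h false n); have := sqr_ge0 (fourier_coef h true n).
  by nra.
move=> H2; have := pi_gt0 R => p0.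
by nra.
Qed.

End conjugate_kernels.

(** * The smoothed kernels *)

Section conjugate_multipliers.
Context (R : realType).
Implicit Types (u v : R -> R) (l : nat -> R).

(** [u] is the part removed from the conjugate kernel: on frequency [n.+1], convolution with
    [cot (x / 2) (1 - u x)] acts as conjugation times the multiplier [l n]. *)
Definition conj_contraction u : Prop := exists N l,
  (forall n, 0 <= l n <= 1) /\
  (forall x, sin (x / 2) != 0 -> 2 * sine_poly N l x = cot (x / 2) * (1 - u x)).

Lemma sine_poly_widen N M l x : (N <= M)%N ->
  sine_poly N l x = sine_poly M (fun n => if (n < N)%N then l n else 0) x.
Proof.
move=> NM; rewrite /sine_poly (big_ord_widen _ (fun n => l n * trig true n x) NM).
by rewrite big_mkcond; apply: eq_bigr => n _; case: ifP => // _; rewrite mul0r.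
Qed.

(** The kernel is affine in [u] and [[0, 1]] is convex, so the multipliers are averaged, after
    padding both sequences with zeros to a common length. *)
Lemma conj_contraction_avg u v : conj_contraction u -> conj_contraction v ->
  conj_contraction (fun x => (u x + v x) / 2).
Proof.
move=> [N [l [l01 lE]]] [M [l' [l'01 l'E]]].
pose t K (k : nat -> R) n := if (n < K)%N then k n else 0.
have t01 K k : (forall n, 0 <= k n <= 1) -> forall n, 0 <= t K k n <= 1.
  by move=> k01 n; rewrite /t; case: ifP => // _; rewrite lexx ler01.
exists (maxn N M), (fun n => (t N l n + t M l' n) / 2); split.
  by move=> n; have := t01 N l l01 n; have := t01 M l' l'01 n; lra.
move=> x sx; have := lE x sx; have := l'E x sx.
rewrite (@sine_poly_widen N (maxn N M)) ?leq_maxl//.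
rewrite (@sine_poly_widen M (maxn N M)) ?leq_maxr//.
rewrite -/(t N l) -/(t M l') => E2 E1.
have -> : sine_poly (maxn N M) (fun n => (t N l n + t M l' n) / 2) x =
  (sine_poly (maxn N M) (t N l) x + sine_poly (maxn N M) (t M l') x) / 2.
  by rewrite /sine_poly -big_split mulr_suml; apply: eq_bigr => n _ /=; ring.
have -> : 1 - (u x + v x) / 2 = ((1 - u x) + (1 - v x)) / 2 by field.
by rewrite [RHS]mulrA mulrDr -E1 -E2; field.
Qed.

(** Telescoping: [sin (n x) + sin ((n+1) x) = cot (x / 2) (cos (n x) - cos ((n+1) x))]. The
    left-hand side is the modified conjugate Dirichlet kernel. *)
Lemma sum_sin_cot (k : nat) (x : R) : sin (x / 2) != 0 ->
  \sum_(n < k) (sin (n%:R * x) + sin (n.+1%:R * x)) = cot (x / 2) * (1 - cos (k%:R * x)).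
Proof.
move=> sx; elim: k => [|k IH]; first by rewrite big_ord0 mul0r cos0 subrr mulr0.
rewrite big_ord_recr/= {}IH /cot.
have -> : k.+1%:R * x = k%:R * x + (x / 2 + x / 2) by rewrite -natr1; field.
rewrite [sin (_ + (_ + _))]sinD [cos (_ + (_ + _))]cosD sinD cosD.
have := cos2Dsin2 (x / 2).
move: sx; move: (sin (x / 2)) (cos (x / 2)) (sin (k%:R * x)) (cos (k%:R * x)) => s c S C s0 cs.
apply/eqP; rewrite -subr_eq0; apply/eqP.
transitivity ((S * s - c * C) / s * (1 - (c ^+ 2 + s ^+ 2))); first by field.
by rewrite cs subrr mulr0.
Qed.

Lemma conj_contraction_cos (k : nat) : conj_contraction (fun x => cos (k%:R * x)).
Proof.
case: k => [|k].
  exists 0%N, (fun=> 0); split; first by move=> _; rewrite lexx ler01.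
  by move=> x _; rewrite /sine_poly big_ord0 mul0r cos0 subrr !mulr0.
(* In [sum_sin_cot] every sine occurs twice except the one of top frequency, whose multiplier is
   therefore one half. *)
exists k.+1, (fun n => if (n < k)%N then 1 else 2^-1); split.
  by move=> n; case: ifP => _; apply/andP; split; lra.
move=> x sx; rewrite -sum_sin_cot// big_split/=.
rewrite big_ord_recl/= mul0r sin0 add0r [in RHS]big_ord_recr/=.
rewrite /sine_poly big_ord_recr/= ltnn.
have -> : \sum_(i < k) sin ((bump 0 i)%:R * x) = \sum_(i < k) sin (i.+1%:R * x) by [].
have -> : \sum_(i < k) ((if (i < k)%N then 1 else 2^-1) * sin (i.+1%:R * x)) =
  \sum_(i < k) sin (i.+1%:R * x).
  by apply: eq_bigr => i _; rewrite ltn_ord mul1r.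
by field.
Qed.

(** The factor [cos (k x)] makes the induction on [m] work: multiplying it by [(1 + cos x) / 2]
    averages [cos (k x)] with the mean of its two neighbours of frequency [k - 1] and [k + 1]. For
    [k = 0] both neighbours are [cos x]. *)
Lemma conj_contraction_halfcos_cos (m k : nat) :
  conj_contraction (fun x => ((1 + cos x) / 2) ^+ m * cos (k%:R * x)).
Proof.
elim: m k => [|m IH] k.
  have -> : (fun x : R => ((1 + cos x) / 2) ^+ 0 * cos (k%:R * x)) = (fun x => cos (k%:R * x)).
    by apply/funext => x; rewrite expr0 mul1r.
  exact: conj_contraction_cos.
case: k => [|k].
  have -> : (fun x : R => ((1 + cos x) / 2) ^+ m.+1 * cos (0%:R * x)) =
    (fun x => (((1 + cos x) / 2) ^+ m * cos (0%:R * x) + ((1 + cos x) / 2) ^+ m * cos (1%:R * x)) / 2).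
    by apply/funext => x; rewrite exprS mul0r cos0 mul1r; field.
  exact: conj_contraction_avg.
pose g j := fun x : R => ((1 + cos x) / 2) ^+ m * cos (j%:R * x).
have -> : (fun x : R => ((1 + cos x) / 2) ^+ m.+1 * cos (k.+1%:R * x)) =
    (fun x => (g k.+1 x + (fun x => (g k.+2 x + g k x) / 2) x) / 2).
  apply/funext => x; rewrite /g exprS.
  have -> : k.+2%:R * x = k.+1%:R * x + x by rewrite -[in LHS]natr1; ring.
  have -> : k%:R * x = k.+1%:R * x - x by rewrite -natr1; ring.
  by rewrite cosB cosD; field.
apply: conj_contraction_avg; first exact: IH.
by apply: conj_contraction_avg; exact: IH.
Qed.

Lemma conj_contraction_halfcos (m : nat) :
  conj_contraction (fun x => ((1 + cos x) / 2) ^+ m).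
Proof.
have [N [l [l01 lE]]] := conj_contraction_halfcos_cos m 0.
exists N, l; split => // x sx; rewrite lE//.
by rewrite mul0r cos0 mulr1.
Qed.

End conjugate_multipliers.

(** * From truncated to smoothed Hilbert transforms *)

Section layer_cake.
Context (R : realType).
Notation mu := (@lebesgue_measure R).

Lemma integrable_le (D : set R) (f g : R -> R) : measurable D ->
  measurable_fun D f -> mu.-integrable D (EFin \o g) ->
  (forall x, D x -> `|f x| <= `|g x|) -> mu.-integrable D (EFin \o f).
Proof.
move=> mD mf ig fg; apply: (@le_integrable _ _ _ mu D mD (EFin \o f) (EFin \o g)) => //.
exact/measurable_EFinP.
Qed.

(** The sum counts the naturals [j < n] below [y]: it is the ceiling of [y], capped at [n]. *)
Lemma sum_ltr_bound (n : nat) (y : R) : 0 <= y ->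
  (y <= n%:R -> y <= \sum_(j < n) (j%:R < y)%R%:R <= y + 1) /\
  (n%:R <= y -> \sum_(j < n) (j%:R < y)%R%:R = n%:R :> R).
Proof.
move=> y0; elim: n => [|n [IH1 IH2]].
  by rewrite big_ord0; split => //; lra.
rewrite big_ord_recr/= -natr1; split => h.
  have [yn|ny] := leP y n%:R; first by rewrite addr0; exact: IH1.
  by rewrite IH2 ?(ltW ny)//=; apply/andP; split; lra.
have ny : n%:R < y by lra.
by rewrite IH2 ?(ltW ny)// ny.
Qed.

(* Second mean value theorem, by slicing [phi] into [n] layers. *)
Lemma Rintegral_layers_le (E : set R) (h phi : R -> R) (d : R) :
  measurable E -> measurable_fun E phi -> (forall x, E x -> 0 <= phi x <= 1) ->
  mu.-integrable E (EFin \o h) ->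
  (forall y, `|\int[mu]_(x in E `&` [set x | y < phi x]) h x| <= d) ->
  `|\int[mu]_(x in E) (phi x * h x)| <= d.
Proof.
move=> mE mphi phi01 ih level.
have mlev y : measurable (E `&` [set x | y < phi x]).
  have -> : [set x | y < phi x] = phi @^-1` `]y, +oo[.
    by apply/seteqP; split => x /=; rewrite in_itv/= andbT.
  by apply: mphi => //; exact: measurable_itv.
pose C := \int[mu]_(x in E) `|h x|.
have C0 : 0 <= C by apply: Rintegral_ge0.
have iab : mu.-integrable E (EFin \o (fun x => `|h x|)) by exact: integrable_norm.
have iphi : mu.-integrable E (EFin \o (fun x => phi x * h x)).
  apply: (integrable_le mE _ ih).
    by apply: measurable_funM => //; apply/measurable_EFinP; case/integrableP : ih.
  move=> x Ex; rewrite normrM.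
  have /andP[p0 p1] := phi01 x Ex.
  by rewrite ler_piMl// ger0_norm.
(* [phi] differs by at most [1 / n.+1] from the average of the indicators of its level sets
   [j / n.+1 < phi]. Each indicator contributes an integral bounded by [d], the replacement costs
   [C / n.+1], and [n] is free. *)
suff H n : `|\int[mu]_(x in E) (phi x * h x)| <= d + n.+1%:R^-1 * C.
  apply/ler_addgt0Pr => e e0.
  have [n] : exists n : nat, C / e < n%:R.
    by exists (Num.bound (C / e)); apply: archi_boundP; rewrite divr_ge0// ltW.
  rewrite ltr_pdivrMr// => Cn; apply: (le_trans (H n)); rewrite lerD2l.
  by rewrite mulrC ler_pdivrMr// mulrC -natr1 mulrDl mul1r; lra.
pose lay j x : R := (\1_[set x | j%:R / n.+1%:R < phi x] x) * h x.
have n0 : 0 < n.+1%:R :> R by [].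
have ilay j : mu.-integrable E (EFin \o lay j).
  apply: (integrable_le mE _ ih).
    apply: measurable_funM.
      apply: (@eq_measurable_fun _ _ _ _ E
          (\1_(E `&` [set x | j%:R / n.+1%:R < phi x]) : R -> R)).
        by move=> x /set_mem Ex; rewrite !indicE in_setI mem_set.
      by apply: measurable_funTS; exact: measurable_indic.
    by apply/measurable_EFinP; case/integrableP : ih.
  move=> x Ex; rewrite /lay normrM ler_piMl//.
  by rewrite indicE; case: (_ \in _); rewrite ?normr0 ?normr1.
have Ilay j : \int[mu]_(x in E) lay j x =
    \int[mu]_(x in E `&` [set x | j%:R / n.+1%:R < phi x]) h x.
  rewrite Rintegral_mkcondr; apply: eq_Rintegral => x _.
  by rewrite /lay indicE patchE; case: (_ \in _); rewrite ?mul1r ?mul0r.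
pose S x := n.+1%:R^-1 * \sum_(j < n.+1) lay j x.
have isum : mu.-integrable E (EFin \o (fun x => \sum_(j < n.+1) lay j x)).
  exact: integrable_bigsum.
have iS : mu.-integrable E (EFin \o S) by exact: integrable_scale.
have -> : \int[mu]_(x in E) (phi x * h x) =
    \int[mu]_(x in E) (phi x * h x - S x) + \int[mu]_(x in E) S x.
  by rewrite RintegralB// subrK.
rewrite addrC; apply: (le_trans (ler_normD _ _)); apply: lerD.
  rewrite RintegralZl// Rintegral_sum// normrM gtr0_norm ?invr_gt0//.
  rewrite ler_pdivrMl//; apply: (le_trans (ler_norm_sum _ _ _)).
  have -> : n.+1%:R * d = \sum_(j < n.+1) d by rewrite sumr_const card_ord mulr_natl.
  by apply: ler_sum => j _; rewrite Ilay.
have iphiS : mu.-integrable E (EFin \o (fun x => phi x * h x - S x)) by exact: integrable_sub.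
apply: (le_trans (le_normr_Rintegral _ iphiS)) => //.
rewrite -RintegralZl//; apply: le_Rintegral => //.
- exact: integrable_norm.
- exact: integrable_scale.
move=> x Ex; have /andP[p0 p1] := phi01 x Ex.
have -> : S x = (n.+1%:R^-1 * \sum_(j < n.+1) (j%:R < n.+1%:R * phi x)%R%:R) * h x.
  rewrite /S /lay -mulr_suml mulrA; congr (_ * _ * _); apply: eq_bigr => j _.
  rewrite indicE; congr (_%:R); congr nat_of_bool.
  apply/idP/idP => [/set_mem/=|].
    by rewrite ltr_pdivrMr// mulrC.
  by move=> hj; apply/mem_set => /=; rewrite ltr_pdivrMr// mulrC.
rewrite -mulrBl normrM ler_wpM2r//.
have nphi : 0 <= n.+1%:R * phi x by rewrite mulr_ge0.
have [/(_ _)/wrap[]] := sum_ltr_bound n.+1 nphi.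
  by rewrite ler_piMr.
set s := \sum_(j < _) _ => /andP[s1 s2] _.
have -> : phi x - n.+1%:R^-1 * s = n.+1%:R^-1 * (n.+1%:R * phi x - s).
  by rewrite mulrBr mulKf.
rewrite normrM gtr0_norm ?invr_gt0// ler_piMr ?invr_ge0//.
by rewrite ler_norml; apply/andP; split; lra.
Qed.

End layer_cake.

(** * Annuli around the singularity *)

Section annuli.
Context (R : realType).
Notation mu := (@lebesgue_measure R).
Implicit Types (t a b : R).

(** With [b = pi] this is the domain of [hilbert_trunc]. The strict inner inequality makes
    consecutive annuli disjoint and leaves a closed segment as the hole. *)
Definition annulus t a b : set R := [set s | a < `|t - s| <= b].

Lemma annulusE t a b : annulus t a b = `[t - b, t + b] `\` `[t - a, t + a].
Proof.
have N c s : (`|t - s| <= c) = (t - c <= s <= t + c).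
  by rewrite ler_norml; apply/andP/andP => -[? ?]; split; lra.
apply/seteqP; split => s /=; rewrite !in_itv/= -!N.
  by move=> /andP[sa sb]; split => //; apply/negP; rewrite -ltNge.
by move=> [sb /negP]; rewrite -ltNge => sa; apply/andP.
Qed.

Lemma measurable_annulus t a b : measurable (annulus t a b).
Proof. by rewrite annulusE; apply: measurableD; exact: measurable_itv. Qed.

Lemma Rintegral_annulus_split (f : R -> R) t a b c : a <= b -> b <= c ->
  mu.-integrable (annulus t a c) (EFin \o f) ->
  \int[mu]_(s in annulus t a c) f s =
  \int[mu]_(s in annulus t a b) f s + \int[mu]_(s in annulus t b c) f s.
Proof.
move=> ab bc; have E : annulus t a c = annulus t a b `|` annulus t b c.
  apply/seteqP; split => s /=.
    by move=> /andP[h1 h2]; case: (leP `|t - s| b) => h; [left|right]; apply/andP.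
  by case=> /andP[h1 h2]; apply/andP; split => //; lra.
rewrite E => i; apply: Rintegral_setU => //; [exact: measurable_annulus..|].
apply/disj_setPS => s [/andP[_ h1] /andP[h2 _]].
by move: h1; rewrite leNgt h2.
Qed.

Lemma Rintegral_disk_split (f : R -> R) t a b : a <= b ->
  mu.-integrable `[t - b, t + b] (EFin \o f) ->
  \int[mu]_(s in `[t - b, t + b]) f s =
  \int[mu]_(s in `[t - a, t + a]) f s + \int[mu]_(s in annulus t a b) f s.
Proof.
move=> ab; have E : `[t - b, t + b]%classic = `[t - a, t + a] `|` annulus t a b.
  rewrite annulusE setDUK//.
  by move=> s /=; rewrite !in_itv/= => /andP[? ?]; apply/andP; split; lra.
rewrite E => i; apply: Rintegral_setU => //; first exact: measurable_annulus.
by rewrite annulusE; apply/disj_setPS => s [h1 [_ h2]].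
Qed.

(** Absolute continuity of the integral, for the restriction of [f] to the large segment. *)
Lemma small_disk (f : R -> R) t b d : 0 < b -> 0 < d ->
  mu.-integrable `[t - b, t + b] (EFin \o f) ->
  exists2 e, 0 < e & forall a, 0 < a -> a <= e -> a <= b ->
    `|\int[mu]_(s in `[t - a, t + a]) f s| <= d.
Proof.
move=> b0 d0 ifb.
have iT : mu.-integrable setT (EFin \o (f \_ `[t - b, t + b])).
  by rewrite -restrict_EFin; apply/(integrable_mkcond _ _).1 => //; exact: measurable_itv.
have [e [e0 He]] := integral_normr_continuous iT d0.
(* A segment of radius [a] has length [2 a], which must stay strictly below [e]. *)
exists (e / 3); first by rewrite divr_gt0.
move=> a a0 ae ab.
have sub : `[t - a, t + a] `<=` `[t - b, t + b].
  by move=> s /=; rewrite !in_itv/= => /andP[? ?]; apply/andP; split; lra.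
have ifa : mu.-integrable `[t - a, t + a] (EFin \o f).
  by apply: integrableS ifb => //; exact: measurable_itv.
apply: (le_trans (le_normr_Rintegral _ ifa)); first exact: measurable_itv.
have -> : \int[mu]_(s in `[t - a, t + a]) `|f s| =
    \int[mu]_(s in `[t - a, t + a]) `|(f \_ `[t - b, t + b]) s|.
  by apply: eq_Rintegral => s /set_mem/sub sb; rewrite patchE mem_set.
apply/ltW/He; first exact: measurable_itv.
rewrite /= lebesgue_measure_itv/= lte_fin; case: ifPn => _; rewrite -?EFinD ?lte_fin//.
by lra.
Qed.

End annuli.

Section half_cotangent.
Context (R : realType).
Notation mu := (@lebesgue_measure R).
Implicit Types (t s a b x : R).

Lemma sin_half_bound a x : 0 <= a -> a <= `|x| -> `|x| <= pi ->
  sin (a / 2) <= `|sin (x / 2)|.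
Proof.
move=> a0 ax xpi; have p0 := pi_gt0 R.
have -> : `|sin (x / 2)| = sin (`|x| / 2).
  rewrite -[in RHS](ger0_norm (sin_ge0_pi (x := `|x| / 2) _)); last first.
    by have := normr_ge0 x => ?; apply/andP; split; lra.
  have [x0|x0] := leP 0 x; first by rewrite (ger0_norm x0).
  by rewrite (ltr0_norm x0) mulNr sinN normrN.
rewrite leNgt ltr_sin; first by rewrite -leNgt ler_pM2r//.
- by rewrite in_itv/=; apply/andP; split; lra.
- by rewrite in_itv/=; apply/andP; split; lra.
Qed.

Lemma sin_half_gt0 a : 0 < a -> a <= pi -> 0 < sin (a / 2).
Proof.
move=> a0 api; apply: sin_gt0_pi; have := pi_gt0 R => p0.
by apply/andP; split; lra.
Qed.

Lemma sin_half_neq0 x : 0 < `|x| -> `|x| <= pi -> sin (x / 2) != 0.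
Proof.
move=> x0 xpi; rewrite -normr_gt0.
exact: lt_le_trans (sin_half_gt0 x0 xpi) (sin_half_bound (normr_ge0 x) (lexx _) xpi).
Qed.

Lemma measurable_halfcot t a : 0 <= a ->
  measurable_fun (annulus t a pi) (fun s => cot ((t - s) / 2)).
Proof.
move=> a0.
have clin : continuous (fun s : R => (t - s) / 2).
  move=> s; apply: cvgM; last exact: cvg_cst.
  by apply: cvgB; [exact: cvg_cst|exact: cvg_id].
have csin : continuous (fun s => sin ((t - s) / 2)).
  by move=> s; apply: (@continuous_comp _ _ _ (fun s => (t - s) / 2)); [exact: clin|exact: continuous_sin].
have ccos : continuous (fun s => cos ((t - s) / 2)).
  by move=> s; apply: (@continuous_comp _ _ _ (fun s => (t - s) / 2)); [exact: clin|exact: continuous_cos].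
pose O := (fun s => sin ((t - s) / 2)) @^-1` [set x | x != 0].
have oO : open O.
  apply: open_comp => [s _|]; first exact: csin.
  exact: open_neq.
apply: (@measurable_funS _ _ _ _ O).
- exact: open_measurable.
- move=> s /= /andP[s1 s2]; apply: sin_half_neq0 => //; exact: le_lt_trans s1.
apply: open_continuous_measurable_fun => // s /set_mem Os.
by apply: cvgM; [exact: ccos|apply: cvgV => //; exact: csin].
Qed.

(** Away from the singularity the cotangent is bounded by [1 / sin (a / 2)]. *)
Lemma integrable_halfcot (F : R -> R) t a : 0 < a -> a <= pi ->
  mu.-integrable `[t - pi, t + pi] (EFin \o F) ->
  mu.-integrable (annulus t a pi) (EFin \o (fun s => F s * cot ((t - s) / 2))).
Proof.
move=> a0 api iF.
have iFa : mu.-integrable (annulus t a pi) (EFin \o F).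
  apply: integrableS iF => //; first exact: measurable_annulus.
  by rewrite annulusE; exact: subDsetl.
have sa0 := sin_half_gt0 a0 api.
apply: (@integrable_le _ _ _ (fun s => (sin (a / 2))^-1 * F s)).
- exact: measurable_annulus.
- apply: measurable_funM; last by apply: measurable_halfcot; exact: ltW.
  by apply/measurable_EFinP; case/integrableP : iFa.
- by apply: integrable_scale => //; exact: measurable_annulus.
move=> s /andP[s1 s2].
have sb := sin_half_bound (ltW a0) (ltW s1) s2.
rewrite !normrM mulrC ler_wpM2r// !normfV (gtr0_norm sa0).
rewrite -[leRHS]mul1r; apply: ler_pM => //.
  by rewrite ler_norml cos_geN1 cos_le1.
by rewrite lef_pV2// posrE (lt_le_trans sa0).
Qed.

(** Since [(1 + cos x) / 2 = cos^2 (x / 2)], this is the weight [1 - cos^(2m) (x / 2)], in the form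
    produced by [conj_contraction_halfcos]. *)
Definition abel_weight (m : nat) x := 1 - ((1 + cos x) / 2) ^+ m.

Lemma halfcos01 x : 0 <= (1 + cos x) / 2 <= 1.
Proof. by have := cos_geN1 x; have := cos_le1 x; lra. Qed.

Lemma abel_weight01 m x : 0 <= abel_weight m x <= 1.
Proof.
have /andP[c0 c1] := halfcos01 x.
have := exprn_ge0 m c0; have := exprn_ile1 m c0 c1; rewrite /abel_weight; lra.
Qed.

Lemma abel_weight_norm m x : abel_weight m `|x| = abel_weight m x.
Proof.
by rewrite /abel_weight; case: (leP 0 x) => x0; rewrite ?(ger0_norm x0) ?(ltr0_norm x0) ?cosN.
Qed.

(** The exponent is [m.+1] because the weight of exponent 0 vanishes identically. *)
Lemma ltr_abel_weight m : {in `[0, pi] &, {mono abel_weight m.+1 : x y / x < y}}.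
Proof.
move=> x y xI yI; rewrite /abel_weight -(ltr_cos xI yI).
have /andP[x0 _] := halfcos01 x; have /andP[y0 _] := halfcos01 y.
by rewrite ltrD2l ltrN2 ltr_pXn2r ?nnegrE// ltr_pM2r// ltrD2l.
Qed.

Lemma continuous_abel_weight m : continuous (abel_weight m).
Proof.
move=> x; apply: cvgB; first exact: cvg_cst.
apply: (@continuous_comp _ _ _ (fun x => (1 + cos x) / 2) (fun y => y ^+ m)); last exact: exprn_continuous.
apply: cvgM; last exact: cvg_cst.
by apply: cvgD; [exact: cvg_cst|exact: continuous_cos].
Qed.

(** The weight is even and increasing on [[0, pi]], so its superlevel sets only raise the inner
    radius; the intermediate value theorem finds it. This feeds [Rintegral_layers_le] with integrals
    over annuli. *)
Lemma abel_weight_level m t a b y : 0 <= a -> a <= b -> b <= pi ->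
  exists2 e, a <= e <= b &
    annulus t a b `&` [set s | y < abel_weight m.+1 (t - s)] = annulus t e b.
Proof.
move=> a0 ab bpi; pose w := abel_weight m.+1.
have mono x z : 0 <= x -> x <= pi -> 0 <= z -> z <= pi -> (w x < w z) = (x < z).
  by move=> *; apply: ltr_abel_weight; rewrite in_itv/=; apply/andP.
have b0 : 0 <= b by lra.
have api : a <= pi by lra.
have [ya|ay] := ltP y (w a).
  exists a; first by rewrite lexx.
  apply/seteqP; split => [s []//|s as_]; split => //=.
  move: as_ => /andP[s1 s2]; rewrite -abel_weight_norm; apply: (lt_trans ya).
  by rewrite mono//; lra.
have [yb|by_] := leP y (w b); last first.
  exists b; first by rewrite lexx andbT.
  apply/seteqP; split => s /=.
    move=> [/andP[s1 s2]]; rewrite -abel_weight_norm => h.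
    have : w b < w `|t - s| := lt_trans by_ h.
    by rewrite mono ?normr_ge0//; lra.
  by move=> /andP[h1 h2]; have := lt_le_trans h1 h2; rewrite ltxx.
have wab : w a <= w b by exact: le_trans yb.
have [] := @IVT _ w a b y ab.
- exact/continuous_subspaceT/continuous_abel_weight.
- by rewrite min_l// max_r// ay.
move=> e; rewrite in_itv/= => /andP[ae eb] we; exists e; first by rewrite ae.
apply/seteqP; split => s /=.
  move=> [/andP[s1 s2]]; rewrite -abel_weight_norm -we mono//; try lra.
  by move=> h; apply/andP.
move=> /andP[s1 s2]; rewrite -abel_weight_norm -we mono//; try lra.
by split => //; apply/andP; split => //; lra.
Qed.

End half_cotangent.

(** * Convergence of the smoothed transforms at a point *)

Section abel_theorem.
Context (R : realType).
Notation mu := (@lebesgue_measure R).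

(* An Abelian theorem: the smoothed kernels average the truncated ones. *)
Lemma abel_cvg (F : R -> R) (K : nat -> R -> R) (t L : R) :
  mu.-integrable `[t - pi, t + pi] (EFin \o F) ->
  (forall m, continuous (K m)) ->
  (forall m x, sin (x / 2) != 0 -> K m x = cot (x / 2) * abel_weight m.+1 x) ->
  \int[mu]_(s in annulus t e pi) (F s * cot ((t - s) / 2)) @[e --> 0^'+] --> L ->
  \int[mu]_(s in `[t - pi, t + pi]) (F s * K m (t - s)) @[m --> \oo] --> L.
Proof.
move=> iF cK KE HL; have p0 := pi_gt0 R.
pose h s := F s * cot ((t - s) / 2).
pose H e := \int[mu]_(s in annulus t e pi) h s.
have mA a b : measurable (annulus t a b) by exact: measurable_annulus.
have ih a : 0 < a -> a <= pi -> mu.-integrable (annulus t a pi) (EFin \o h).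
  by move=> a0 api; exact: integrable_halfcot.
have annS a b c d : c <= a -> b <= d -> annulus t a b `<=` annulus t c d.
  by move=> ca bd s /andP[h1 h2]; apply/andP; split; lra.
have iK m : mu.-integrable `[t - pi, t + pi] (EFin \o (fun s => F s * K m (t - s))).
  apply: integrable_mul_continuous => //.
  by apply: continuous_reflect; exact: cK.
have wE m a b : 0 <= a -> b <= pi ->
    \int[mu]_(s in annulus t a b) (F s * K m (t - s)) =
    \int[mu]_(s in annulus t a b) (abel_weight m.+1 (t - s) * h s).
  move=> a0 bpi; apply: eq_Rintegral => s /set_mem/andP[s1 s2].
  rewrite KE; first by rewrite /h; ring.
  by apply: sin_half_neq0; lra.
apply/cvgrPdist_le => d d0.
(* One fifth for the disk around the singularity, two for the inner annulus, one for the defect of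
   the weight on the outer annulus, one for the distance from [H e0] to [L]. *)
pose d5 := d / 5.
have d50 : 0 < d5 by rewrite divr_gt0.
have [e1 /= e10 He1] := (cvgrPdist_le _ _).1 HL d5 d50.
pose e0 := Num.min (e1 / 2) 1.
have e00 : 0 < e0 by rewrite lt_min ltr01 andbT divr_gt0.
have e0pi : e0 < pi.
  have e01 : e0 <= 1 by rewrite ge_min lexx orbT.
  by have := pi_ge2 R => h2; lra.
have Hclose a : 0 < a -> a <= e0 -> `|H a - L| <= d5.
  move=> a0 ae; rewrite distrC; apply: He1 => //=.
  rewrite sub0r normrN gtr0_norm//.
  have : e0 <= e1 / 2 by rewrite ge_min lexx.
  by move=> ?; lra.
(* Beyond radius [e0] the weight [abel_weight m.+1] differs from 1 by at most [r ^+ m.+1], with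
   [r < 1]. *)
pose r := (1 + cos e0) / 2.
pose C := \int[mu]_(s in annulus t e0 pi) `|h s|.
have iabs : mu.-integrable (annulus t e0 pi) (EFin \o (fun s => `|h s|)).
  by apply: integrable_norm; exact/ih/ltW.
have e0I : e0 \in `[0, pi] by rewrite in_itv/=; apply/andP; split; lra.
have r0 : 0 <= r by have /andP[] := halfcos01 e0.
have r1 : r < 1.
  have : cos e0 < cos 0 by rewrite ltr_cos// in_itv/= lexx ltW.
  by rewrite cos0 /r; lra.
have rC : r ^+ m.+1 * C @[m --> \oo] --> 0.
  rewrite -[X in _ --> X](mul0r C); apply: cvgM; last exact: cvg_cst.
  by rewrite (cvg_shiftS (fun m => r ^+ m)); apply: cvg_expr; rewrite ger0_norm.
have /(cvgrPdist_le _ _).1/(_ d5 d50) := rC.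
apply: filterS => m; rewrite sub0r normrN => rCm.
have {}rCm : r ^+ m.+1 * C <= d5 by apply: le_trans (ler_norm _) rCm.
(* With [m] now fixed, the radius [a] of the disk may depend on it, because the bound on the inner
   annulus is uniform in [a]. *)
have [e2 e20 He2] := small_disk p0 d50 (iK m).
pose a := Num.min e2 e0.
have a0 : 0 < a by rewrite lt_min e20.
have ae2 : a <= e2 by rewrite ge_min lexx.
have ae0 : a <= e0 by rewrite ge_min lexx orbT.
have api : a <= pi by lra.
have iKa : mu.-integrable (annulus t a pi) (EFin \o (fun s => F s * K m (t - s))).
  apply: integrableS (iK m) => //; first exact: mA.
  by rewrite annulusE; exact: subDsetl.
rewrite (@Rintegral_disk_split _ _ t a pi)//.
rewrite (@Rintegral_annulus_split _ _ t a e0 pi)//; last exact: ltW.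
have B1 := He2 a a0 ae2 api.
rewrite !wE//; try lra.
have iha := ih a a0 api.
have ihe := ih e0 e00 (ltW e0pi).
have mw b : measurable_fun (annulus t b pi) (fun s => abel_weight m.+1 (t - s)).
  apply: measurable_funTS; apply: continuous_measurable_fun.
  by apply: continuous_reflect; exact: continuous_abel_weight.
(* On a level set, which is [annulus t b e0], the integral of [h] is [H b - H e0], and both terms
   are within [d5] of [L]. *)
have B2 : `|\int[mu]_(s in annulus t a e0) (abel_weight m.+1 (t - s) * h s)| <= 2 * d5.
  have S1 : annulus t a e0 `<=` annulus t a pi by apply: annS => //; exact: ltW.
  apply: Rintegral_layers_le => //.
  - by apply: measurable_funS (mw a) => //; exact: mA.
  - by move=> s _; exact: abel_weight01.
  - by apply: integrableS iha => //; exact: mA.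
  move=> y; have [b /andP[ab be] ->] := abel_weight_level m t y (ltW a0) ae0 (ltW e0pi).
  have b0 : 0 < b by exact: lt_le_trans ab.
  have bpi : b <= pi by lra.
  have := @Rintegral_annulus_split _ h t b e0 pi be (ltW e0pi) (ih b b0 bpi).
  rewrite -/(H b) -/(H e0) => EH.
  have -> : \int[mu]_(s in annulus t b e0) h s = (H b - L) - (H e0 - L) by rewrite EH; ring.
  apply: (le_trans (ler_normB _ _)).
  by have := Hclose b b0 be; have := Hclose e0 e00 (lexx _); lra.
have iw : mu.-integrable (annulus t e0 pi) (EFin \o (fun s => abel_weight m.+1 (t - s) * h s)).
  apply: (integrable_le (g := h)) => //.
    apply: measurable_funM; first exact: mw.
    by apply/measurable_EFinP; case/integrableP : ihe.
  move=> s _; rewrite normrM ler_piMl//.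
  by have /andP[w0 w1] := abel_weight01 m.+1 (t - s); rewrite ger0_norm.
have B3 : `|\int[mu]_(s in annulus t e0 pi) (abel_weight m.+1 (t - s) * h s) - H e0| <= d5.
  rewrite /H -RintegralB//; last exact: mA.
  have iwh := integrable_sub (mA e0 pi) iw ihe.
  apply: (le_trans (le_normr_Rintegral _ iwh)); first exact: mA.
  apply: le_trans rCm; rewrite /C -RintegralZl; [|exact: mA|exact: iabs]; apply: le_Rintegral.
  - exact: mA.
  - exact: integrable_norm.
  - by apply: integrable_scale => //; exact: mA.
  move=> s /andP[s1 s2].
  have -> : abel_weight m.+1 (t - s) * h s - h s = - (((1 + cos (t - s)) / 2) ^+ m.+1 * h s).
    by rewrite /abel_weight; ring.
  rewrite normrN normrM ler_wpM2r//.
  have /andP[w0 w1] := halfcos01 (t - s).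
  rewrite ger0_norm ?exprn_ge0// lerXn2r ?nnegrE//.
  rewrite /r ler_pM2r// lerD2l leNgt.
  have -> : cos (t - s) = cos `|t - s| by case: (leP 0 (t - s)) => x0; rewrite ?(ger0_norm x0) ?(ltr0_norm x0) ?cosN.
  rewrite ltr_cos//; first by rewrite -leNgt ltW.
  by rewrite in_itv/= normr_ge0.
have B4 := Hclose e0 e00 (lexx _).
have tri (I1 I2 I3 J : R) : `|I1| <= d5 -> `|I2| <= 2 * d5 -> `|I3 - J| <= d5 ->
    `|J - L| <= d5 -> `|L - (I1 + (I2 + I3))| <= d.
  move=> C1 C2 C3 C4.
  have -> : L - (I1 + (I2 + I3)) = - (I1 + I2 + (I3 - J) + (J - L)) by ring.
  rewrite normrN.
  have := ler_normD (I1 + I2 + (I3 - J)) (J - L).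
  have := ler_normD (I1 + I2) (I3 - J).
  have := ler_normD I1 I2.
  by rewrite /d5 in C1 C2 C3 C4 *; lra.
exact: tri B1 B2 B3 B4.
Qed.

End abel_theorem.

(** * The upper bound *)

(** The measure is by construction an outer measure, hence monotone on all sets. This is how
    [hilbert_ge f 1] is compared with measurable sets. *)
Lemma le_lebesgue_measure (R : realType) (A B : set R) : A `<=` B ->
  (lebesgue_measure A <= lebesgue_measure B)%E.
Proof. by move=> AB; exact: (le_outer_measure (mu_ext (wlength (@idfun R)))). Qed.

Section fatou_markov.
Context (R : realType).
Notation mu := (@lebesgue_measure R).

(** Markov's inequality for the lower limit [g] of the [G m], then Fatou's lemma. The measurable set
    [B] on which [g >= 1] contains [A]. *)
Lemma fatou_markov (D A : set R) (G : nat -> R -> R) (b : \bar R) :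
  measurable D -> A `<=` D ->
  (forall m, measurable_fun D (G m)) -> (forall m x, 0 <= G m x) ->
  (forall x, A x -> exists2 L : R, 1 <= L & G m x @[m --> \oo] --> L) ->
  (forall m, (\int[mu]_(x in D) (G m x)%:E <= b)%E) ->
  (mu A <= b)%E.
Proof.
move=> mD AD mG G0 AL Gb.
pose g x := limn_einf (fun m => (G m x)%:E).
have mEG m : measurable_fun D (fun x => (G m x)%:E) by exact/measurable_EFinP.
have mg : measurable_fun D g.
  have -> : g = -%E \o (fun x => limn_esup (fun m => (- (G m x)%:E)%E)).
    by apply/funext => x /=; rewrite -limn_einfN; congr limn_einf;
       apply/funext => m /=; rewrite ?oppeK ?opprK.
  apply: measurableT_comp => //.
  apply: (@measurable_fun_limn_esup _ _ _ D (fun m x => (- (G m x)%:E)%E)) => m.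
  by apply: measurableT_comp.
have g0 x : (0 <= g x)%E.
  rewrite /g limn_einf_lim; apply: lime_ge; first exact: is_cvg_einfs.
  by apply: nearW => n; apply/ereal_infP => _ [m _ <-]; rewrite lee_fin.
pose B := D `&` [set x | (1 <= g x)%E].
have mB : measurable B by exact: emeasurable_fun_c_infty.
have AB : A `<=` B.
  move=> x Ax; split; first exact: AD.
  have [L L1 GL] := AL x Ax.
  have GLe : (G m x)%:E @[m --> \oo] --> L%:E.
    by apply: cvg_EFin => //; exact: nearW.
  have /= := cvg_limn_einf_sup GLe; rewrite -/(g x) => -[-> _].
  by rewrite lee_fin.
apply: (le_trans (le_lebesgue_measure AB)).
have -> : mu B = (\int[mu]_(x in B) 1)%E by rewrite integral_cst// mul1e.
apply: (@le_trans _ _ (\int[mu]_(x in B) g x)%E).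
  apply: ge0_le_integral => //; last by move=> x [].
  by apply: measurable_funS mg => // x [].
apply: (@le_trans _ _ (\int[mu]_(x in D) g x)%E).
  by apply: ge0_subset_integral => // x [].
apply: (@le_trans _ _ (limn_einf (fun m => \int[mu]_(x in D) (G m x)%:E)%E)).
  by apply: (@fatou _ _ _ mu D mD (fun m x => (G m x)%:E)) => // m x _; rewrite lee_fin.
rewrite limn_einf_lim; apply: lime_le; first exact: is_cvg_einfs.
apply: nearW => n; apply: le_trans (Gb n); apply: ereal_inf_lbound.
by exists n => /=.
Qed.

End fatou_markov.

Section circle_functions.
Context (R : realType).
Notation mu := (@lebesgue_measure R).
Notation D := (`[- (pi : R), pi]%classic : set R).

Lemma expi_periodic (t : R) : expi (t + 2 * pi) = expi t.
Proof. by rewrite /expi [2 * pi]mulr_natl sinD2pi cosD2pi. Qed.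

(** The addition formulas express [cos (k t)] and [sin (k t)] through [cos t] and [sin t], so
    trigonometric polynomials descend to the circle without a choice of argument. *)
Lemma trig_expi b n (t t' : R) : expi t = expi t' -> trig b n t = trig b n t'.
Proof.
move=> [ec es]; suff H k : sin (k%:R * t) = sin (k%:R * t') /\ cos (k%:R * t) = cos (k%:R * t').
  by rewrite /trig; case: b; [exact: (H _).1|exact: (H _).2].
elim: k => [|k [IHs IHc]]; first by rewrite !mul0r.
by rewrite -natr1 !mulrDl !mul1r !sinD !cosD IHs IHc ec es.
Qed.

Lemma Lp2_normE (f : R[i] -> R) :
  Lp_norm 2 f ^+ 2 = (2 * pi)^-1 * \int[mu]_(s in D) (f (expi s) ^+ 2).
Proof.
rewrite /Lp_norm powR12_sqrt.
  rewrite sqr_sqrtr; last first.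
    by rewrite mulr_ge0 ?invr_ge0 ?mulr_ge0 ?pi_ge0//; apply: Rintegral_ge0 => x _; exact: powR_ge0.
  by congr (_ * _); apply: eq_Rintegral => x _; rewrite powR_mulrn// real_normK ?num_real.
by rewrite mulr_ge0 ?invr_ge0 ?mulr_ge0 ?pi_ge0//; apply: Rintegral_ge0 => x _; exact: powR_ge0.
Qed.

Lemma in_L2_integrable (f : R[i] -> R) : in_Lp 2 f ->
  mu.-integrable D (EFin \o (fun s => f (expi s) ^+ 2)) /\
  mu.-integrable D (EFin \o (fun s => f (expi s))).
Proof.
move=> [mf ifp].
have i2 : mu.-integrable D (EFin \o (fun s => f (expi s) ^+ 2)).
  apply: eq_integrable ifp => // s _ /=.
  by rewrite powR_mulrn// real_normK ?num_real.
(* The bound [|y| <= 1 + y^2] gives integrability from square integrability on a set of finite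
   measure. *)
split=> //; apply: (integrable_le (g := fun s => 1 + f (expi s) ^+ 2)) => //.
  apply: integrable_add => //.
  by apply: continuous_integrable_itv => x; exact: cvg_cst.
move=> s _; rewrite [leRHS]ger0_norm; last by rewrite addr_ge0// sqr_ge0.
rewrite -(real_normK (num_real (f (expi s)))).
by have := sqr_ge0 (`|f (expi s)| - 1); rewrite sqrrB expr1n mulr1; have := normr_ge0 (f (expi s)); lra.
Qed.

Lemma hilbert_trunc_annulus (f : R[i] -> R) (t e : R) :
  hilbert_trunc f t e =
  (2 * pi)^-1 * \int[mu]_(s in annulus t e pi) (f (expi s) * cot ((t - s) / 2)).
Proof. by []. Qed.

End circle_functions.

Section weak_type.
Context (R : realType).
Notation mu := (@lebesgue_measure R).
Notation D := (`[- (pi : R), pi]%classic : set R).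
Variable (f : R[i] -> R).
Hypothesis f2 : in_Lp 2 f.
Let F s := f (expi s).
Let J := \int[mu]_(s in D) (F s ^+ 2).

(** Invariance under a change of argument is recorded because a point of [hilbert_ge] comes with
    some argument [t'], possibly outside [D], at which the principal value is taken. *)
Lemma smoothed_hilbert : exists Q : nat -> R -> R,
  [/\ forall m, continuous (Q m), forall m, \int[mu]_(t in D) Q m t = 0,
      forall m, \int[mu]_(t in D) (Q m t ^+ 2) <= J,
      forall m t t', expi t = expi t' -> Q m t = Q m t' &
      forall t (L : R), hilbert_trunc f t e @[e --> 0^'+] --> L ->
        Q m t @[m --> \oo] --> L].
Proof.
have [iF2 iF] := in_L2_integrable f2.
have p0 := pi_gt0 R; have q0 : 2 * pi != 0 :> R by rewrite mulf_neq0// gt_eqF.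
have /choice[p pE] : forall m, exists p : nat * (nat -> R),
    (forall n, 0 <= p.2 n <= 1) /\
    (forall x, sin (x / 2) != 0 -> 2 * sine_poly p.1 p.2 x = cot (x / 2) * abel_weight m.+1 x).
  by move=> m; have [N [l Nl]] := conj_contraction_halfcos R m.+1; exists (N, l).
pose K m x := 2 * sine_poly (p m).1 (p m).2 x.
pose T m := trig_poly (p m).1 (fun b n => if b then 2 * (p m).2 n * fourier_coef F false n
                      else - (2 * (p m).2 n * fourier_coef F true n)).
have TE m t : \int[mu]_(s in D) (F s * K m (t - s)) = T m t by exact: sine_conv.
have cT m : continuous (T m) by exact: continuous_trig_poly.
have iT m : mu.-integrable D (EFin \o T m) by exact: continuous_integrable_itv.
exists (fun m t => (2 * pi)^-1 * T m t); split.
- by move=> m t; apply: cvgM; [exact: cvg_cst|exact: cT].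
- by move=> m; rewrite RintegralZl// Rintegral_trig_poly mulr0.
- move=> m.
  have -> : \int[mu]_(t in D) (((2 * pi)^-1 * T m t) ^+ 2) =
      ((2 * pi) ^+ 2)^-1 * \int[mu]_(t in D) (T m t ^+ 2).
    rewrite -RintegralZl//; first by apply: eq_Rintegral => t _; rewrite exprMn exprVn.
    by apply: continuous_integrable_itv; apply: continuous_sqr; exact: cT.
  rewrite ler_pdivrMl ?exprn_gt0 ?mulr_gt0//.
  by apply: sine_conv_sq => //; exact: (pE m).1.
- move=> m t t' tt'; congr (_ * _); apply: eq_bigr => n _.
  by rewrite !(trig_expi _ _ tt').
move=> t L HL.
have pF s : F (s + 2 * pi) = F s by rewrite /F expi_periodic.
have iFt := integrable_periodic pF iF t.
have cK m : continuous (K m).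
  by move=> x; apply: cvgM; [exact: cvg_cst|exact: continuous_sine_poly].
have HL' : \int[mu]_(s in annulus t e pi) (F s * cot ((t - s) / 2)) @[e --> 0^'+] --> 2 * pi * L.
  have -> : (fun e => \int[mu]_(s in annulus t e pi) (F s * cot ((t - s) / 2))) =
      (fun e => 2 * pi * hilbert_trunc f t e).
    by apply/funext => e; rewrite hilbert_trunc_annulus mulVKf.
  by apply: cvgM; [exact: cvg_cst|exact: HL].
have := abel_cvg iFt cK (fun m => (pE m).2) HL'.
(* The principal value uses the period centred at [t], the Fourier coefficients the fixed period
   [D]; periodicity identifies the integrals. *)
have -> : (fun m => \int[mu]_(s in `[t - pi, t + pi]) (F s * K m (t - s))) = (fun m => T m t).
  apply/funext => m; rewrite -TE.
  have pK s : K m (t - (s + 2 * pi)) = K m (t - s).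
    by rewrite /K -(sine_poly_periodic _ _ (t - (s + _))); congr (2 * sine_poly _ _ _); ring.
  apply: (@Rintegral_periodic _ (fun s => F s * K m (t - s))).
    by move=> s; rewrite pF pK.
  apply: integrable_mul_continuous => //.
  by apply: continuous_reflect; exact: cK.
move=> HT; rewrite -[L](mulKf q0).
by apply: cvgM; [exact: cvg_cst|exact: HT].
Qed.

Lemma weak_type_bound (c : R) : 0 <= c <= 1 ->
  (((2 * pi)^-1)%:E * arclength (hilbert_ge f 1)
        <= (c ^+ 2 * Lp_norm 2 f ^+ 2 + (1 - c) ^+ 2)%:E)%E.
Proof.
move=> /andP[c0 c1].
have [Q [cQ Q0 QJ Qe Qcvg]] := smoothed_hilbert.
have p0 := pi_gt0 R; have q0 : 0 < 2 * pi :> R by rewrite mulr_gt0.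
rewrite Lp2_normE -/J.
rewrite lee_pdivrMl// -EFinM.
pose G m t := (c * Q m t + (1 - c)) ^+ 2.
have cG m : continuous (G m).
  apply: continuous_sqr => t; apply: cvgD; last exact: cvg_cst.
  by apply: cvgM; [exact: cvg_cst|exact: cQ].
apply: (@fatou_markov _ D _ G) => //.
- by move=> t [/= + _]; rewrite !in_itv/= => /andP[/ltW -> ->].
- by move=> m; apply: measurable_funTS; exact: continuous_measurable_fun.
- by move=> m x; exact: sqr_ge0.
- move=> t [_ [_ [t' [tt' Ht' L1]]]].
  have HQ := Qcvg t' (hilbert f t') Ht'.
  (* The map [c y + 1 - c] is nondecreasing and fixes 1, so its value at [hilbert f t' >= 1] is at
     least 1. *)
  exists ((c * hilbert f t' + (1 - c)) ^+ 2).
    rewrite -[leLHS](expr1n _ 2) lerXn2r ?nnegrE//; last first.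
      by have := ler_wpM2l c0 L1; lra.
    by rewrite addr_ge0 ?mulr_ge0 ?subr_ge0// (le_trans ler01).
  have -> : (fun m => G m t) = (fun m => (c * Q m t' + (1 - c)) ^+ 2).
    by apply/funext => m; rewrite /G (Qe _ _ _ tt').
  apply: (@continuous_cvg _ _ _ _ _ _ (fun y : R => y ^+ 2)); first exact: exprn_continuous.
  apply: cvgD; last exact: cvg_cst.
  by apply: cvgM; [exact: cvg_cst|exact: HQ].
move=> m.
have iG : mu.-integrable D (EFin \o G m) by exact: continuous_integrable_itv.
rewrite -(fineK (integrable_fin_num _ iG))// lee_fin -/(Rintegral mu D (G m)).
have iQ : mu.-integrable D (EFin \o Q m) by exact: continuous_integrable_itv.
have iQ2 : mu.-integrable D (EFin \o (fun t => Q m t ^+ 2)).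
  by apply: continuous_integrable_itv; apply: continuous_sqr; exact: cQ.
have i1 : mu.-integrable D (EFin \o (fun=> (1 - c) ^+ 2)).
  by apply: continuous_integrable_itv => t; exact: cvg_cst.
have -> : Rintegral mu D (G m) =
  \int[mu]_(t in D) (c ^+ 2 * Q m t ^+ 2 + (2 * c * (1 - c) * Q m t + (1 - c) ^+ 2)).
  by apply: eq_Rintegral => t _; rewrite /G; ring.
have mD : measurable D by exact: measurable_itv.
have j1 := integrable_scale (c ^+ 2) mD iQ2.
have j2 := integrable_scale (2 * c * (1 - c)) mD iQ.
rewrite RintegralD//; last exact: integrable_add.
rewrite RintegralD// (@RintegralZl _ _ _ mu D _ _ mD iQ2) (@RintegralZl _ _ _ mu D _ _ mD iQ) Q0 mulr0 add0r Rintegral_cst//= lebesgue_measure_itv/=.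
rewrite lte_fin gtrN//=.
have := ler_wpM2l (sqr_ge0 c) (QJ m).
have e (p j : R) : p != 0 ->
    2 * p * (c ^+ 2 * ((2 * p)^-1 * j) + (1 - c) ^+ 2) = c ^+ 2 * j + (1 - c) ^+ 2 * (p - - p).
  by move=> pn0; field.
by move=> h; rewrite e ?lerD2r// gt_eqF.
Qed.

End weak_type.

(** * Hilbert transforms of sine polynomials *)

Section reflection.
Context (R : realType).
Notation mu := (@lebesgue_measure R).

Lemma measurable_reflect (c : R) : measurable_fun [set: R] (fun x : R => c - x).
Proof.
by apply: continuous_measurable_fun => x; apply: cvgB; [exact: cvg_cst|exact: cvg_id].
Qed.

Lemma lebesgue_measure_reflect (c : R) (A : set R) : measurable A ->
  pushforward lebesgue_measure ((fun x => c - x) : _ -> measurableTypeR R) A =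
  lebesgue_measure A.
Proof.
move=> mA; apply/esym/lebesgue_measure_unique => //=; first exact: measurable_reflect.
move=> ? _ [[u v]] _ <-; rewrite /pushforward.
have -> : (fun x : R => c - x) @^-1` `]u, v] = `[c - v, c - u[%classic.
  by apply/seteqP; split => z /=; rewrite !in_itv/= => /andP[? ?]; apply/andP; split; lra.
rewrite !lebesgue_measure_itv /= !lte_fin ltrD2l ltrN2.
by case: ifP => // _; rewrite -!EFinD; congr (_%:E); ring.
Qed.

Lemma ge0_integral_reflect (c : R) (D : set R) (f : R -> \bar R) :
  measurable D -> measurable_fun D f -> (forall x, (0 <= f x)%E) ->
  (\int[mu]_(x in D) f x =
   \int[mu]_(x in (fun x => (c - x)%R) @^-1` D) f (c - x)%R)%E.
Proof.
move=> mD mf f0.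
transitivity (\int[pushforward lebesgue_measure
    ((fun x => (c - x)%R) : R -> measurableTypeR R)]_(x in D) f x)%E; last first.
  by rewrite ge0_integral_pushforward//; exact: measurable_reflect.
apply: eq_measure_integral => /=; first exact: measurable_reflect.
by move=> ? A mA _; exact/esym/lebesgue_measure_reflect.
Qed.

(** Reflection about [c / 2] exchanges the positive and negative parts of [h]. *)
Lemma Rintegral_odd (D : set R) (c : R) (h : R -> R) :
  measurable D -> (fun x => c - x) @^-1` D = D ->
  (forall x, h (c - x) = - h x) -> measurable_fun D h ->
  \int[mu]_(x in D) h x = 0.
Proof.
move=> mD DD odd mh.
have mEh : measurable_fun D (EFin \o h) by exact/measurable_EFinP.
suff E : (\int[mu]_(x in D) ((EFin \o h)^\+ x) = \int[mu]_(x in D) ((EFin \o h)^\- x))%E.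
  rewrite /Rintegral integralE -[X in (X - _)%E]/(\int[mu]_(x in D) (EFin \o h)^\+ x)%E E.
  (* If both parts have infinite integral, the difference is infinite and [fine] returns 0 by
     default. *)
  by case: (\int[mu]_(x in D) _)%E => //= r; rewrite subrr.
rewrite (@ge0_integral_reflect c)//; last exact: measurable_funepos.
rewrite DD; apply: eq_integral => x _.
by rewrite funeposE funenegE /= odd.
Qed.

Lemma annulus_reflect (t a b : R) : (fun x => 2 * t - x) @^-1` annulus t a b = annulus t a b.
Proof.
have e s : `|t - (2 * t - s)| = `|t - s|.
  by rewrite -normrN; congr `|_|; ring.
by apply/seteqP; split => s; rewrite /annulus/= e.
Qed.

End reflection.

Section hilbert_of_sines.
Context (R : realType).
Notation mu := (@lebesgue_measure R).
Notation D := (`[- (pi : R), pi]%classic : set R).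

(** For an integrable function the principal value is the ordinary integral. *)
Lemma cvg_disk (h : R -> R) (t : R) :
  mu.-integrable `[t - pi, t + pi] (EFin \o h) ->
  \int[mu]_(s in annulus t e pi) h s @[e --> 0^'+] --> \int[mu]_(s in `[t - pi, t + pi]) h s.
Proof.
move=> ih; apply/cvgrPdist_le => d d0.
have [e e0 He] := small_disk (pi_gt0 R) d0 ih.
near=> a.
rewrite (@Rintegral_disk_split _ _ t a pi)//; last by apply: ltW; near: a; exact/nbhs_right_lt/pi_gt0.
rewrite addrK; apply: He => //.
- by near: a; exact: nbhs_right_le.
- by apply: ltW; near: a; exact/nbhs_right_lt/pi_gt0.
Unshelve. all: by end_near. Qed.

(** The right-hand side is the Dirichlet kernel with its top frequency halved: the singularity
    cancels and the constant term is 1. *)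
Lemma sin_cot_dirichlet (n : nat) (x : R) : sin (x / 2) != 0 ->
  sin (n.+1%:R * x) * cot (x / 2) =
  1 + (\sum_(j < n) 2 * trig false j x + trig false n x).
Proof.
move=> s0; elim: n => [|n IH].
  rewrite big_ord0 add0r /trig mul1r /cot.
  have -> : sin x = sin (x / 2 + x / 2) by congr sin; field.
  have -> : cos x = cos (x / 2 + x / 2) by congr cos; field.
  rewrite sinD cosD; have := cos2Dsin2 (x / 2).
  move: s0; move: (sin (x / 2)) (cos (x / 2)) => s c s0 cs.
  apply/eqP; rewrite -subr_eq0; apply/eqP.
  transitivity (c ^+ 2 + s ^+ 2 - 1); first by field.
  by rewrite cs subrr.
rewrite big_ord_recr/=.
have -> : 1 + (\sum_(j < n) 2 * trig false j x + 2 * trig false n x + trig false n.+1 x) =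
  sin (n.+1%:R * x) * cot (x / 2) + trig false n x + trig false n.+1 x by rewrite IH; ring.
rewrite /trig /cot.
have -> : n.+2%:R * x = n.+1%:R * x + (x / 2 + x / 2) by rewrite -[in LHS]natr1; field.
rewrite [sin (_ + (_ + _))]sinD [cos (_ + (_ + _))]cosD sinD cosD.
have := cos2Dsin2 (x / 2).
move: s0; move: (sin (x / 2)) (cos (x / 2)) (sin (n.+1%:R * x)) (cos (n.+1%:R * x)) => s c S C s0 cs.
apply/eqP; rewrite -subr_eq0; apply/eqP.
transitivity ((S * c / s + C) * (c ^+ 2 + s ^+ 2 - 1)); first by field.
by rewrite cs subrr mulr0.
Qed.

Lemma Rintegral_trig_shift n (t : R) : \int[mu]_(s in `[t - pi, t + pi]) trig false n (t - s) = 0.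
Proof.
pose a (b : bool) (k : nat) := if k == n then trig b n t else 0.
have tE s : trig false n (t - s) = trig_poly n.+1 a s.
  rewrite /trig_poly big_ord_recr/= big1 ?add0r; last first.
    by move=> i _; rewrite /a (ltn_eqF (ltn_ord i)) !mul0r addr0.
  by rewrite /a eqxx /trig mulrBr cosB.
under eq_Rintegral do rewrite tE.
rewrite Rintegral_periodic ?Rintegral_trig_poly//; last exact/continuous_integrable_itv/continuous_trig_poly.
move=> s; rewrite /trig_poly; apply: eq_bigr => k _.
by rewrite !(trig_expi _ _ (expi_periodic s)).
Qed.

(** Expand the sine at [s = t - (t - s)]. The term with the cosine of [t - s] is odd about [t] after
    multiplication by the cotangent and vanishes in every truncation; the other is
    [- trig false n t] times the bounded kernel [E], whose integral over a period is [2 * pi]. *)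
Lemma hilbert_sine (n : nat) (t : R) :
  \int[mu]_(s in annulus t e pi) (trig true n s * cot ((t - s) / 2)) @[e --> 0^'+]
  --> - (2 * pi) * trig false n t.
Proof.
pose E s : R := 1 + (\sum_(j < n) 2 * trig false j (t - s) + trig false n (t - s)).
have ctr b k : continuous (fun s : R => trig b k (t - s)).
  by apply: continuous_reflect; exact: continuous_trig.
have itr b k a c : mu.-integrable `[a, c] (EFin \o (fun s : R => trig b k (t - s))).
  exact/continuous_integrable_itv/ctr.
have i1 a c : mu.-integrable `[a, c] (EFin \o (fun=> 1 : R)).
  by apply: continuous_integrable_itv => x; exact: cvg_cst.
have mI a c : measurable (`[a : R, c]%classic) by exact: measurable_itv.
have is2 a c : mu.-integrable `[a, c] (EFin \o (fun s => \sum_(j < n) 2 * trig false j (t - s))).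
  by apply: integrable_bigsum => // j _; exact: integrable_scale.
have is3 a c := integrable_add (mI a c) (is2 a c) (itr false n a c).
have iE : mu.-integrable `[t - pi, t + pi] (EFin \o E) by exact: integrable_add.
have IE : \int[mu]_(s in `[t - pi, t + pi]) E s = 2 * pi.
  rewrite RintegralD// RintegralD// Rintegral_trig_shift addr0 Rintegral_sum//; last first.
    by move=> j _; exact: integrable_scale.
  rewrite big1 ?addr0; last first.
    by move=> j _; rewrite RintegralZl// Rintegral_trig_shift mulr0.
  rewrite Rintegral_cst//= lebesgue_measure_itv/= lte_fin ltrD2l gtrN ?pi_gt0//=.
  by ring.
have := cvg_disk iE; rewrite IE => HE.
have -> : - (2 * pi) * trig false n t = - trig false n t * (2 * pi) by ring.
have : - trig false n t * \int[mu]_(s in annulus t e pi) E s @[e --> 0^'+] -->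
    - trig false n t * (2 * pi) by apply: cvgM; [exact: cvg_cst|exact: HE].
apply: cvg_trans; apply: near_eq_cvg; near=> e.
have e0 : 0 < e by [].
have epi : e <= pi by apply: ltW; near: e; exact/nbhs_right_lt/pi_gt0.
have mA : measurable (annulus t e pi) by exact: measurable_annulus.
have ic b : mu.-integrable (annulus t e pi) (EFin \o (fun s => trig b n (t - s) * cot ((t - s) / 2))).
  exact: integrable_halfcot.
have -> : \int[mu]_(s in annulus t e pi) (trig true n s * cot ((t - s) / 2)) =
  \int[mu]_(s in annulus t e pi) (trig true n t * (trig false n (t - s) * cot ((t - s) / 2))
     + - trig false n t * E s).
  apply: eq_Rintegral => s /set_mem/andP[s1 s2].
  rewrite /E -sin_cot_dirichlet; last by apply: sin_half_neq0; lra.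
  have {1}-> : s = t - (t - s) by ring.
  by rewrite /trig mulrBr sinB; ring.
have iEa : mu.-integrable (annulus t e pi) (EFin \o E).
  apply: integrableS iE => //.
  by rewrite annulusE; exact: subDsetl.
have j1 := integrable_scale (trig true n t) mA (ic false).
have j2 := integrable_scale (- trig false n t) mA iEa.
rewrite [RHS]RintegralD//.
have -> : \int[mu]_(s in annulus t e pi)
    (trig true n t * (trig false n (t - s) * cot ((t - s) / 2))) =
  trig true n t * \int[mu]_(s in annulus t e pi) (trig false n (t - s) * cot ((t - s) / 2)).
  by apply: RintegralZl => //; exact: ic.
have -> : \int[mu]_(s in annulus t e pi) (- trig false n t * E s) =
  - trig false n t * \int[mu]_(s in annulus t e pi) E s by exact: RintegralZl.
suff -> : \int[mu]_(s in annulus t e pi) (trig false n (t - s) * cot ((t - s) / 2)) = 0.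
  by rewrite mulr0 add0r.
apply: (@Rintegral_odd _ _ (2 * t)) => //; first exact: annulus_reflect.
  move=> s; have -> : t - (2 * t - s) = - (t - s) by ring.
  by rewrite /trig mulrN cosN mulNr /cot cosN sinN invrN !mulrN.
by apply/measurable_EFinP; case/integrableP : (ic false).
Unshelve. all: by end_near. Qed.

End hilbert_of_sines.

(** * Extremal functions *)

Section cosine_polynomials.
Context (R : realType).
Implicit Types (g h : R -> R).

Definition cosine_poly g : Prop := exists N (c : nat -> R),
  forall t, g t = \sum_(k < N) c k * cos (k%:R * t).

Lemma cosine_poly_cos (k : nat) : cosine_poly (fun t => cos (k%:R * t)).
Proof.
exists k.+1, (fun j => (j == k)%:R) => t.
rewrite big_ord_recr/= eqxx mul1r big1 ?add0r// => i _.
by rewrite ltn_eqF// mul0r.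
Qed.

Lemma cosine_polyD g h : cosine_poly g -> cosine_poly h ->
  cosine_poly (fun t => g t + h t).
Proof.
move=> [N [c gE]] [M [d hE]].
exists (maxn N M), (fun n => (if (n < N)%N then c n else 0) + (if (n < M)%N then d n else 0)) => t.
have widen K K' (e : nat -> R) : (K <= K')%N -> \sum_(k < K) e k * cos (k%:R * t) =
    \sum_(k < K') (if (k < K)%N then e k else 0) * cos (k%:R * t).
  move=> KK'; rewrite (big_ord_widen _ (fun k => e k * cos (k%:R * t)) KK') big_mkcond.
  by apply: eq_bigr => k _; case: ifP => // _; rewrite mul0r.
rewrite gE hE (widen _ _ _ (leq_maxl N M)) (widen _ _ _ (leq_maxr N M)) -big_split/=.
by apply: eq_bigr => k _; rewrite mulrDl.
Qed.

Lemma cosine_polyZ (a : R) g : cosine_poly g -> cosine_poly (fun t => a * g t).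
Proof.
move=> [N [c gE]]; exists N, (fun k => a * c k) => t.
by rewrite gE mulr_sumr; apply: eq_bigr => k _; rewrite mulrA.
Qed.

Lemma eq_cosine_poly g h : g =1 h -> cosine_poly g -> cosine_poly h.
Proof. by move=> /funext ->. Qed.

Lemma cosine_polyM_cos g : cosine_poly g -> cosine_poly (fun t => g t * cos t).
Proof.
move=> [N [c gE]].
apply: (@eq_cosine_poly (fun t => \sum_(k < N) c k * (cos (k%:R * t) * cos t))).
  by move=> t; rewrite gE mulr_suml; apply: eq_bigr => k _; rewrite mulrA.
elim: N {gE} => [|N IH].
  by exists 0%N, (fun=> 0) => t; rewrite !big_ord0.
apply: (@eq_cosine_poly (fun t => \sum_(k < N) c k * (cos (k%:R * t) * cos t) +
  c N * (cos (N%:R * t) * cos t))); first by move=> t; rewrite big_ord_recr.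
apply: cosine_polyD => //; apply: cosine_polyZ.
(* Frequency 0 is separate, as its lower neighbour in the product formula would be negative. *)
case: N {IH} => [|N].
  by apply: eq_cosine_poly (cosine_poly_cos 1) => t; rewrite mul0r cos0 !mul1r.
have := cosine_polyZ 2^-1 (cosine_polyD (cosine_poly_cos N) (cosine_poly_cos N.+2)).
apply: eq_cosine_poly => t.
have -> : N.+2%:R * t = N.+1%:R * t + t by rewrite -[in LHS]natr1; ring.
have -> : N%:R * t = N.+1%:R * t - t by rewrite -natr1; ring.
by rewrite cosB cosD; field.
Qed.

Lemma cosine_poly_horner (p : {poly R}) : cosine_poly (fun t => p.[cos t]).
Proof.
elim/poly_ind: p => [|p a IH].
  by exists 0%N, (fun=> 0) => t; rewrite big_ord0 horner0.
have := cosine_polyD (cosine_polyM_cos IH) (cosine_polyZ a (cosine_poly_cos 0)).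
by apply: eq_cosine_poly => t; rewrite mul0r cos0 mulr1 !hornerE.
Qed.

End cosine_polynomials.

(** * Polynomials in the cosine close to the indicator of an arc *)

Section step_approximation.
Context (R : realType).

Lemma bernoulli_ge (M : nat) (y : R) : 0 <= y <= 1 -> 1 - M%:R * y <= (1 - y) ^+ M.
Proof.
move=> /andP[y0 y1]; elim: M => [|M IH]; first by rewrite mul0r subr0 expr0.
rewrite exprS -natr1; apply: (@le_trans _ _ ((1 - y) * (1 - M%:R * y))).
  have : 0 <= M%:R * (y * y) by rewrite !mulr_ge0.
  by lra.
by rewrite ler_wpM2l// subr_ge0.
Qed.

(** The inductive step is [(1 - y) (1 + (M+1) y) <= 1 + M y]. It makes [(1 - y)^M] small once [M y]
    is large. *)
Lemma bernoulli_le (M : nat) (y : R) : 0 <= y <= 1 -> (1 - y) ^+ M * (1 + M%:R * y) <= 1.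
Proof.
move=> /andP[y0 y1]; elim: M => [|M IH]; first by rewrite mul0r addr0 expr0 mul1r.
rewrite exprS -natr1; apply: le_trans IH.
rewrite [(1 - y) * _]mulrC -mulrA ler_wpM2l ?exprn_ge0 ?subr_ge0//.
have : 0 <= M%:R * (y * y) by rewrite !mulr_ge0.
have : 0 <= y * y by rewrite mulr_ge0.
by lra.
Qed.

(* The polynomials [(1 - x^n)^(k^n)] tend to 1 on [0, 1/k[ and to 0 on ]1/k, 1]. *)
Lemma step_polynomial (a0 a1 d : R) : 0 <= a0 -> a0 < a1 -> a1 <= 1 -> 0 < d ->
  exists p : {poly R}, [/\ forall t, 0 <= p.[cos t] <= 1,
    forall t, `|t| <= pi * a0 -> 1 - d <= p.[cos t] &
    forall t, pi * a1 <= `|t| -> `|t| <= pi -> p.[cos t] <= d].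
Proof.
move=> a00 a01 a11 d0; have p0 := pi_gt0 R.
(* This is [sin^2 (t / 2)], affine in [cos t] and increasing in [|t|] up to [pi]. *)
pose v t : R := (1 - cos t) / 2.
have vnorm t : v `|t| = v t.
  by rewrite /v; case: (leP 0 t) => t0; rewrite ?(ger0_norm t0) ?(ltr0_norm t0) ?cosN.
have v01 t : 0 <= v t <= 1 by have := cos_geN1 t; have := cos_le1 t; rewrite /v; lra.
have vmono x y : 0 <= x -> x <= y -> y <= pi -> v x <= v y.
  move=> x0 xy ypi; rewrite /v ler_pM2r// lerD2l lerN2 leNgt ltr_cos.
  - by rewrite -leNgt.
  - by rewrite in_itv/=; apply/andP; split; lra.
  - by rewrite in_itv/=; apply/andP; split; lra.
have b1 : pi * a1 <= pi by rewrite ger_pMr.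
have b01 : pi * a0 < pi * a1 by rewrite ltr_pM2l.
have b0 : 0 <= pi * a0 by rewrite mulr_ge0// ltW.
have v0v1 : v (pi * a0) < v (pi * a1).
  rewrite /v ltr_pM2r// ltrD2l ltrN2 ltr_cos// in_itv/=.
  - by apply/andP; split; lra.
  - by apply/andP; split; lra.
set v0 := v (pi * a0) in v0v1; set v1 := v (pi * a1) in v0v1.
have v00 : 0 <= v0 by have /andP[] := v01 (pi * a0).
have [s [s0 v0s sv1]] : exists s : R, [/\ 0 < s, v0 < s & s < v1].
  by exists ((v0 + v1) / 2); split; lra.
have v10 : 0 < v1 by lra.
(* The variable is [x = v / (k s)]: [k s >= 1] keeps it in [[0, 1]], and the jump at [x = 1 / k]
   falls at [v = s], between [v0] and [v1]. *)
have [k ks] : exists k : nat, 1 <= k%:R * s.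
  exists (Num.bound s^-1).
  by rewrite -ler_pdivrMr// mul1r; apply/ltW/archi_boundP; rewrite invr_ge0 ltW.
have k0 : 0 < k%:R :> R by rewrite -(pmulr_lgt0 _ s0) (lt_le_trans ltr01).
have : \forall n \near \oo, (v0 / s) ^+ n <= d /\ (s / v1) ^+ n <= d.
  have H q : 0 <= q -> q < 1 -> \forall n \near \oo, q ^+ n <= d.
    move=> q0 q1; have /cvgrPdist_le/(_ d d0) : q ^+ n @[n --> \oo] --> 0.
      by apply: cvg_expr; rewrite ger0_norm.
    by apply: filterS => n; rewrite sub0r normrN ger0_norm// exprn_ge0.
  apply: filterI; apply: H.
  - by rewrite divr_ge0// ltW.
  - by rewrite ltr_pdivrMr// mul1r; lra.
  - by rewrite divr_ge0// ltW.
  - by rewrite ltr_pdivrMr// mul1r; lra.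
move=> [n _ /(_ n (leqnn n))] [Hq Hr].
exists ((1 - ((2 * k%:R * s)^-1 *: (1 - 'X)) ^+ n) ^+ (k ^ n)%N).
pose y t := (v t / (k%:R * s)) ^+ n.
have pE t : ((1 - ((2 * k%:R * s)^-1 *: (1 - 'X)) ^+ n) ^+ (k ^ n)%N).[cos t] = (1 - y t) ^+ (k ^ n).
  rewrite !hornerE/= /y /v; congr ((1 - _ ^+ _) ^+ _).
  by field; rewrite !gt_eqF.
have y01 t : 0 <= y t <= 1.
  have /andP[vt0 vt1] := v01 t.
  have ks0 : 0 < k%:R * s by rewrite mulr_gt0.
  have z0 : 0 <= v t / (k%:R * s) by rewrite divr_ge0// ltW.
  have z1 : v t / (k%:R * s) <= 1 by rewrite ler_pdivrMr// mul1r (le_trans vt1).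
  by rewrite /y exprn_ge0//= exprn_ile1.
(* This product governs both Bernoulli bounds: it is at most [(v0 / s)^n] on the inner arc and at
   least [(v1 / s)^n] outside the outer one. *)
have My t : (k ^ n)%:R * y t = (v t / s) ^+ n.
  rewrite natrX /y -exprMn; congr (_ ^+ _); field.
  by rewrite !gt_eqF.
split=> t; rewrite pE.
- have /andP[yt0 yt1] := y01 t.
  by rewrite exprn_ge0 ?subr_ge0//= exprn_ile1 ?subr_ge0// gerBl.
- move=> ta; apply: le_trans (bernoulli_ge _ (y01 t)); rewrite My lerD2l lerN2.
  have /andP[vt0 _] := v01 t.
  apply: le_trans Hq; rewrite lerXn2r ?nnegrE ?divr_ge0 ?(ltW s0)//.
  rewrite ler_pM2r ?invr_gt0// -vnorm; apply: vmono => //; lra.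
- move=> ta tpi; have := bernoulli_le (k ^ n) (y01 t); rewrite My.
  set V := (1 - y t) ^+ _ => HV.
  have V0 : 0 <= V by rewrite exprn_ge0// subr_ge0; have /andP[] := y01 t.
  apply: le_trans Hr.
  have vt : v1 <= v t by rewrite -vnorm; apply: vmono => //; lra.
  have z : (v1 / s) ^+ n <= (v t / s) ^+ n.
    have /andP[vt0 _] := v01 t.
    by rewrite lerXn2r ?nnegrE ?divr_ge0 ?(ltW s0) ?(ltW v10)// ler_pM2r ?invr_gt0.
  have -> : (s / v1) ^+ n = ((v1 / s) ^+ n)^-1 by rewrite -[RHS]exprVn [in RHS]invf_div.
  have v1s : 0 < v1 / s := divr_gt0 v10 s0.
  rewrite -[leRHS]mul1r ler_pdivlMr ?exprn_gt0//.
  by apply: le_trans HV; rewrite ler_wpM2l//; lra.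
Qed.

End step_approximation.

Section extremal_functions.
Context (R : realType).
Notation mu := (@lebesgue_measure R).
Notation D := (`[- (pi : R), pi]%classic : set R).

(** An argument of each point is chosen; off the circle the default argument 0 is used. *)
Lemma exists_circle_function (F : R -> R) :
  (forall s s', expi s = expi s' -> F s = F s') ->
  exists f : R[i] -> R, forall s, f (expi s) = F s.
Proof.
move=> Fe; exists (fun z => F (xget 0 [set s | expi s = z])) => s.
by apply: Fe; apply: (@xgetPex _ 0 [set s' | expi s' = expi s]); exists s.
Qed.

Lemma unit_circle_expi (t : R) : unit_circle (expi t).
Proof. by rewrite /unit_circle/= normc_def/= cos2Dsin2 sqrtr1. Qed.

Lemma hilbert_sine_poly (f : R[i] -> R) (N : nat) (l : nat -> R) (t : R) :
  (forall s, f (expi s) = sine_poly N l s) ->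
  hilbert_trunc f t e @[e --> 0^'+] --> - \sum_(n < N) l n * trig false n t.
Proof.
move=> fE; have q0 : 2 * pi != 0 :> R by rewrite mulf_neq0// gt_eqF// pi_gt0.
pose I n e := \int[mu]_(s in annulus t e pi) (trig true n s * cot ((t - s) / 2)).
have HI : (2 * pi)^-1 * (\sum_(n < N) l n * I n e) @[e --> 0^'+] -->
    (2 * pi)^-1 * (\sum_(n < N) l n * (- (2 * pi) * trig false n t)).
  apply: cvgM; first exact: cvg_cst.
  apply: (@cvg_big _ _ +%R) => [|n _]; first exact: add_continuous.
  by apply: cvgM; [exact: cvg_cst|exact: hilbert_sine].
have -> : - \sum_(n < N) l n * trig false n t =
    (2 * pi)^-1 * (\sum_(n < N) l n * (- (2 * pi) * trig false n t)).
  rewrite mulr_sumr -sumrN; apply: eq_bigr => n _.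
  have : pi != 0 :> R by rewrite gt_eqF// pi_gt0.
  by move: (pi : R) (l n) (trig _ _ _) => p a b pn0; field.
apply: cvg_trans HI; apply: near_eq_cvg; near=> e.
have e0 : 0 < e by [].
have epi : e <= pi by apply: ltW; near: e; exact/nbhs_right_lt/pi_gt0.
have mA : measurable (annulus t e pi) by exact: measurable_annulus.
have iI n : mu.-integrable (annulus t e pi) (EFin \o (fun s => trig true n s * cot ((t - s) / 2))).
  by apply: integrable_halfcot => //; exact/continuous_integrable_itv/continuous_trig.
rewrite hilbert_trunc_annulus; congr (_ * _).
transitivity (\int[mu]_(s in annulus t e pi)
    (\sum_(n < N) l n * (trig true n s * cot ((t - s) / 2)))).
  rewrite Rintegral_sum//; last by move=> n _; exact: integrable_scale.
  by apply: eq_bigr => n _; rewrite RintegralZl//; exact: iI.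
apply: eq_Rintegral => s _; rewrite fE /sine_poly mulr_suml.
by apply: eq_bigr => n _; rewrite mulrA.
Unshelve. all: by end_near. Qed.

Lemma in_L2_sine_poly (f : R[i] -> R) (N : nat) (l : nat -> R) :
  (forall s, f (expi s) = sine_poly N l s) -> in_Lp 2 f.
Proof.
move=> /funext fE.
have E : f \o @expi R = sine_poly N l by exact: fE.
split.
  by rewrite E; apply: measurable_funTS; apply: continuous_measurable_fun; exact: continuous_sine_poly.
have : mu.-integrable D (EFin \o (fun s => sine_poly N l s ^+ 2)).
  by apply: continuous_integrable_itv; apply: continuous_sqr; exact: continuous_sine_poly.
apply: eq_integrable => // s _ /=.
by rewrite powR_mulrn// real_normK ?num_real// -E.
Qed.

(** Parseval's identity sees only the squares of the coefficients, so a sine polynomial and its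
    conjugate have the same norm. *)
Lemma Rintegral_cosine_sine_sq (N : nat) (l : nat -> R) :
  \int[mu]_(s in D) (sine_poly N l s ^+ 2) =
  \int[mu]_(s in D) ((\sum_(n < N) l n * trig false n s) ^+ 2).
Proof.
transitivity (\int[mu]_(s in D) (trig_poly N (fun b n => if b then l n else 0) s ^+ 2)).
  by apply: eq_Rintegral => s _; congr (_ ^+ 2); apply: eq_bigr => n _; rewrite mul0r add0r.
transitivity (\int[mu]_(s in D) (trig_poly N (fun b n => if b then 0 else l n) s ^+ 2)).
  rewrite !Rintegral_trig_poly_sq; congr (_ * _); apply: eq_bigr => n _.
  by rewrite addrC.
by apply: eq_Rintegral => s _; congr (_ ^+ 2); apply: eq_bigr => n _; rewrite mul0r addr0.
Qed.

Lemma cosine_poly_mean (g : R -> R) : cosine_poly g ->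
  exists N (m : R) (l : nat -> R), forall t, g t = m + \sum_(n < N) l n * trig false n t.
Proof.
move=> [[|N] [c gE]].
  by exists 0%N, 0, (fun=> 0) => t; rewrite gE !big_ord0 addr0.
exists N, (c 0%N), (fun n => c n.+1) => t.
by rewrite gE big_ord_recl/= mul0r cos0 mulr1.
Qed.

(** Here [a0] and [a1] are the normalized lengths of the arcs between which [g] falls from about 1
    to about 0. As [d] tends to 0 the norm bound tends to [a1 / (1 - a1)]. *)
Lemma near_extremal (a0 a1 d : R) : 0 <= a0 -> a0 < a1 -> 0 < d -> a1 + 2 * d < 1 ->
  exists f : R[i] -> R, [/\ in_Lp 2 f,
    Lp_norm 2 f ^+ 2 <= ((1 - d) / (1 - a1 - 2 * d) - 1) * (1 + d / (1 - a1 - 2 * d)) &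
    (a0%:E <= ((2 * pi)^-1)%:E * arclength (hilbert_ge f 1))%E].
Proof.
move=> a00 a01 d0 ad; have p0 := pi_gt0 R; have q0 : 0 < 2 * pi :> R by rewrite mulr_gt0.
have a11 : a1 <= 1 by lra.
have [p [p01 plow phigh]] := step_polynomial a00 a01 a11 d0.
pose g t := p.[cos t].
have [N [m [l gE]]] : exists N (m : R) (l : nat -> R), forall t, g t = m + \sum_(n < N) l n * trig false n t.
  exact/cosine_poly_mean/cosine_poly_horner.
pose P t : R := \sum_(n < N) l n * trig false n t.
have PE : P = trig_poly N (fun b n => if b then 0 else l n).
  by apply/funext => t; apply: eq_bigr => n _; rewrite mul0r addr0.
have cP : continuous P by rewrite PE; exact: continuous_trig_poly.
have gP : g = (fun t => m + P t) by exact/funext.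
have cg : continuous g by rewrite gP => t; apply: cvgD; [exact: cvg_cst|exact: cP].
have mD : measurable D by exact: measurable_itv.
have iP : mu.-integrable D (EFin \o P) by exact: continuous_integrable_itv.
have ig : mu.-integrable D (EFin \o g) by exact: continuous_integrable_itv.
have ic (x : R) : mu.-integrable D (EFin \o (fun=> x)).
  by apply: continuous_integrable_itv => t; exact: cvg_cst.
have Ic (x : R) : \int[mu]_(t in D) x = 2 * pi * x.
  rewrite Rintegral_cst//= lebesgue_measure_itv/= lte_fin gtrN//=.
  by ring.
have Ig : \int[mu]_(t in D) g t = 2 * pi * m.
  by rewrite gP RintegralD// Ic PE Rintegral_trig_poly addr0.
have m0 : 0 <= m.
  have : 0 <= \int[mu]_(t in D) g t by apply: Rintegral_ge0 => t _; have /andP[] := p01 t.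
  by rewrite Ig pmulr_rge0.
have m1 : m <= a1 + d.
  have mI : measurable (`[- (pi * a1), pi * a1]%classic : set R) by exact: measurable_itv.
  pose u t : R := \1_(`[- (pi * a1), pi * a1]) t.
  have iu : mu.-integrable D (EFin \o u).
    apply: (integrable_le (g := fun=> 1)) => //.
      by apply: measurable_funTS; exact: measurable_indic.
    by move=> t _; rewrite /u indicE; case: (_ \in _); rewrite ?normr0 ?normr1.
  have b0 : 0 < pi * a1 by rewrite mulr_gt0//; lra.
  have b1 : pi * a1 <= pi by rewrite ger_pMr.
  have Iu : \int[mu]_(t in D) u t = 2 * pi * a1.
    rewrite /Rintegral integral_indic// setIidl; last first.
      by move=> t /=; rewrite !in_itv/= => /andP[? ?]; apply/andP; split; lra.
    by rewrite /= lebesgue_measure_itv/= lte_fin gtrN//=; ring.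
  have : \int[mu]_(t in D) g t <= \int[mu]_(t in D) (u t + d).
    apply: le_Rintegral => //; first exact: integrable_add.
    move=> t; rewrite /= in_itv/= => /andP[t1 t2].
    have /andP[_ g1] := p01 t.
    have [ta|ta] := leP `|t| (pi * a1).
      rewrite /u indicE mem_set/=; first by rewrite /g; lra.
      by rewrite in_itv/= -ler_norml.
    have := phigh t (ltW ta); rewrite ler_norml t1 t2 => /(_ isT) gd.
    have : 0 <= u t by rewrite /u indicE.
    by rewrite /g; lra.
  by rewrite Ig RintegralD// Iu Ic -mulrDr ler_pM2l.
(* The smallest value guaranteed for [g - m] on the inner arc, so that [(g - m) / w] is at least 1
   there. *)
pose w := 1 - d - m.
have w0 : 0 < 1 - a1 - 2 * d by lra.
have wle : 1 - a1 - 2 * d <= w by rewrite /w; lra.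
have w1 : 0 < w by lra.
(* As [g^2 <= g] for values in [[0, 1]], the variance is at most that of an indicator of the same
   mean. *)
have IP2 : \int[mu]_(t in D) (P t ^+ 2) <= 2 * pi * (m * (1 - m)).
  have -> : 2 * pi * (m * (1 - m)) = \int[mu]_(t in D) ((1 - 2 * m) * g t + m ^+ 2).
    rewrite RintegralD//; last exact: integrable_scale.
    by rewrite RintegralZl// Ig Ic; ring.
  apply: le_Rintegral => //.
  - by apply: continuous_integrable_itv; apply: continuous_sqr; exact: cP.
  - by apply: integrable_add => //; exact: integrable_scale.
  move=> t _; have /andP[g0 g1] := p01 t.
  have -> : P t = g t - m by rewrite gP addrC addKr.
  have : g t * g t <= g t by rewrite ler_piMl.
  by rewrite !expr2; lra.
(* The sign compensates for the Hilbert transform sending a sine to minus the cosine. *)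
pose l' n := - (w^-1 * l n).
have [f fE] : exists f : R[i] -> R, forall s, f (expi s) = sine_poly N l' s.
  apply: exists_circle_function => s s' ss'; apply: eq_bigr => n _.
  by rewrite (trig_expi _ _ ss').
exists f; split; first exact: in_L2_sine_poly fE.
- rewrite Lp2_normE.
  have -> : \int[mu]_(s in D) (f (expi s) ^+ 2) = \int[mu]_(s in D) ((w^-1) ^+ 2 * P s ^+ 2).
    transitivity (\int[mu]_(s in D) (sine_poly N l' s ^+ 2)).
      by apply: eq_Rintegral => s _; rewrite fE.
    rewrite Rintegral_cosine_sine_sq; apply: eq_Rintegral => s _.
    rewrite -exprMn -[RHS]sqrrN; congr (_ ^+ 2).
    by rewrite -mulNr mulr_sumr; apply: eq_bigr => n _; rewrite /l'; ring.
  rewrite RintegralZl//; last first.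
    by apply: continuous_integrable_itv; apply: continuous_sqr; exact: cP.
  rewrite ler_pdivrMl// mulrC exprVn ler_pdivrMr ?exprn_gt0//.
  apply: (le_trans IP2); rewrite -[leRHS]mulrA ler_pM2l//.
  (* Eliminating [m] leaves two nonnegative factors, each decreasing in [w], so [w] may be replaced
     by its lower bound [1 - a1 - 2 d]. *)
  have -> : m * (1 - m) = (((1 - d) / w - 1) * (1 + d / w)) * w ^+ 2.
    have -> : m = 1 - d - w by rewrite /w; ring.
    by field; rewrite gt_eqF.
  rewrite ler_wpM2r ?sqr_ge0//.
  have iw : w^-1 <= (1 - a1 - 2 * d)^-1 by rewrite lef_pV2.
  apply: ler_pM.
  - by rewrite subr_ge0 ler_pdivlMr// mul1r /w; lra.
  - by rewrite addr_ge0// divr_ge0// ltW.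
  - by rewrite lerD2r ler_wpM2l//; lra.
  - by rewrite lerD2l ler_wpM2l// ltW.
rewrite lee_pdivlMl// -EFinM.
have b0 : 0 <= pi * a0 by rewrite mulr_ge0// ltW.
have -> : (2 * pi * a0)%:E = mu `[- (pi * a0), pi * a0].
  rewrite lebesgue_measure_itv/= lte_fin; case: ltP => h.
    by rewrite -EFinD; congr (_%:E); ring.
  by congr (_%:E); lra.
apply: le_lebesgue_measure => t; rewrite /= in_itv/= -ler_norml => ta.
have b1 : pi * a0 < pi by rewrite gtr_pMr//; lra.
split.
  by move: ta; rewrite ler_norml in_itv/= => /andP[? ?]; apply/andP; split; lra.
split; first exact: unit_circle_expi.
have H := hilbert_sine_poly (t := t) fE.
exists t; split => //; first exact: cvgP H.
rewrite /hilbert (cvg_lim _ H)//.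
have -> : - \sum_(n < N) l' n * trig false n t = w^-1 * (g t - m).
  rewrite gP addrC addKr mulr_sumr -sumrN; apply: eq_bigr => n _.
  by rewrite /l'; ring.
rewrite ler_pdivlMl// mulr1 /w.
by have := plow t ta; rewrite /g; lra.
Qed.

End extremal_functions.

(** * Choice of the arc length *)

Section sharpness.
Context (R : realType).

Lemma exists_threshold (c K : R) : 0 <= c <= 1 -> K < (1 - c) ^+ 2 ->
  exists b, 0 < b < 1 /\ K < b - c ^+ 2 * (b / (1 - b)).
Proof.
move=> /andP[c0 c1] Kc.
have [c0'|cn0] := eqVneq c 0.
  move: Kc; rewrite c0' subr0 expr1n => K1.
  (* For [c = 0] the gain is [b] itself: any [b] strictly between [K] and 1 will do, and [2^-1]
     keeps it positive. *)
  exists (Num.max (2^-1) ((1 + K) / 2)); rewrite expr0n/= mul0r subr0.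
  by rewrite lt_max gt_max lt_max; split; [apply/andP; split; [apply/orP; left|apply/andP; split]|apply/orP; right]; lra.
have [c1'|cn1] := eqVneq c 1.
  move: Kc; rewrite c1' subrr expr0n/= => K0.
  (* For [c = 1] the gain is [- b^2 / (1 - b)], which tends to 0 with [b] while [K] is negative. *)
  pose b := Num.min (2^-1) (- K / 2).
  have b0 : 0 < b by rewrite lt_min; apply/andP; split; lra.
  have b2 : b <= 2^-1 by rewrite ge_min lexx.
  have bK : b <= - K / 2 by rewrite ge_min lexx orbT.
  exists b; split; first by apply/andP; split; lra.
  rewrite expr1n mul1r -subr_gt0.
  have -> : b - b / (1 - b) - K = (- K * (1 - b) - b * b) / (1 - b) by field; lra.
  by rewrite divr_gt0//; [nra|lra].
have cp : 0 < c by rewrite lt_def cn0.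
have cl : c < 1 by rewrite lt_def eq_sym cn1.
exists (1 - c); split; first by apply/andP; split; lra.
suff -> : 1 - c - c ^+ 2 * ((1 - c) / (1 - (1 - c))) = (1 - c) ^+ 2 by [].
by field; rewrite subKr.
Qed.

Lemma additive_constant_sharp (c K : R) : 0 <= c <= 1 -> K < (1 - c) ^+ 2 ->
  exists f : R[i] -> R, in_Lp 2 f /\
    ((c ^+ 2 * Lp_norm 2 f ^+ 2 + K)%:E
       < ((2 * pi)^-1)%:E * arclength (hilbert_ge f 1))%E.
Proof.
move=> c01 Kc; have [b [/andP[b0 b1] Kb]] := exists_threshold c01 Kc.
pose N d : R := ((1 - d) / (1 - b - 2 * d) - 1) * (1 + d / (1 - b - 2 * d)).
(* Lower bound for the measure minus [c^2] times the squared norm when [near_extremal] is applied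
   with arcs [b - d] and [b]. It is continuous at 0, where it exceeds [K]. *)
pose psi d : R := b - d - c ^+ 2 * N d.
have cvgd : d @[d --> (0:R)^'+] --> (0 : R).
  by apply: cvg_at_right_filter; exact: cvg_id.
have Hinv : (1 - b - 2 * d)^-1 @[d --> 0^'+] --> (1 - b)^-1.
  apply: cvgV; first by rewrite subr_eq0 gt_eqF.
  have : 1 - b - 2 * d @[d --> (0 : R)^'+] --> 1 - b - 2 * 0.
    by apply: cvgB; [exact: cvg_cst|apply: cvgM; [exact: cvg_cst|exact: cvgd]].
  by rewrite mulr0 subr0.
have Hpsi : psi d @[d --> 0^'+] --> psi 0.
  have E0 : 1 - b - 2 * 0 = 1 - b by rewrite mulr0 subr0.
  rewrite /psi /N !E0.
  apply: cvgB; first by apply: cvgB; [exact: cvg_cst|exact: cvgd].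
  apply: cvgM; first exact: cvg_cst.
  apply: cvgM.
    apply: cvgB; last exact: cvg_cst.
    by apply: cvgM; [apply: cvgB; [exact: cvg_cst|exact: cvgd]|exact: Hinv].
  apply: cvgD; first exact: cvg_cst.
  by apply: cvgM; [exact: cvgd|exact: Hinv].
have psi0 : psi 0 = b - c ^+ 2 * (b / (1 - b)).
  by rewrite /psi /N; field; lra.
(* The bound [b] makes the inner arc [b - d] nonnegative, and [(1 - b) / 2] gives [b + 2 d < 1]. *)
have /filter_ex [d [Kd [d0 dsmall]]] : \forall d \near 0^'+,
    K < psi d /\ (0 < d /\ d < Num.min b ((1 - b) / 2)).
  apply: filterI.
    by apply: (cvgr_gt _ Hpsi); rewrite psi0.
  apply: filterI; first exact: nbhs_right_gt.
  by apply: nbhs_right_lt; rewrite lt_min b0/=; lra.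
move: dsmall; rewrite lt_min => /andP[db db2].
have [] := @near_extremal R (b - d) b d; try lra.
move=> f [f2 fN fA]; exists f; split => //; apply: lt_le_trans fA.
rewrite lte_fin; have := ler_wpM2l (sqr_ge0 c) fN.
by move: Kd; rewrite /psi /N; lra.
Qed.

End sharpness.

Theorem theorem1p3 (R : realType) (c : R) (hc : 0 <= c <= 1) :
  (forall f : R[i] -> R, in_Lp 2 f ->
     (((2 * pi)^-1)%:E * arclength (hilbert_ge f 1)
        <= (c ^+ 2 * Lp_norm 2 f ^+ 2 + (1 - c) ^+ 2)%:E)%E) /\
  (forall K : R, K < (1 - c) ^+ 2 ->
     exists f : R[i] -> R, in_Lp 2 f /\
       ((c ^+ 2 * Lp_norm 2 f ^+ 2 + K)%:E
          < ((2 * pi)^-1)%:E * arclength (hilbert_ge f 1))%E).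
Proof.
split=> [f f2|K Kc]; first exact: weak_type_bound.
exact: additive_constant_sharp.
Qed.
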